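(* Let $m\in\mathbb{N}$, $m\ge 1$, and let $\sigma:\{1,\ldots,m+1\}\to\{1,\ldots,m+1\}$ be a separable $(m+1)$-snake with $\sigma(m)>\sigma(m+1)$. One can choose polynomials $a_1(x),\ldots,a_{m+1}(x)\in\mathbb{R}[x]$ with $a_i(0)=0$ for all $i$ and $a_1\prec_+a_2\prec_+\cdots\prec_+a_{m+1}$ whose contact tree is one of the binary separating trees of $\sigma$ (the leaf $a_i$ of the contact tree corresponding to the leaf $\sigma(i)$ of the separating tree, for every $i$). For any such choice, define $Q_x(y)\in\mathbb{R}[x][y]$ by $$Q_x(y):=(m+2)\int_0^y\prod_{i=1}^{m+1}\bigl(t-a_i(x)\bigr)\,\mathrm{d}t .$$ Then for all sufficiently small real $x>0$ the polynomial $Q_x(y)$ in the variable $y$ is an $(m+2)$-Morse polynomial, and the Arnold snake associated to $Q_x(y)$ is $\sigma$.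
   Context: **Snakes.** A finite sequence $[b_1,\ldots,b_n]$ of pairwise distinct real numbers is alternating if $b_1>b_2<b_3>\cdots$ or $b_1<b_2>b_3<\cdots$. A permutation $\sigma$ of $\{1,\ldots,n\}$ is an $n$-snake if $[\sigma(1),\ldots,\sigma(n)]$ is alternating. The snake of an alternating sequence $[b_1,\ldots,b_n]$ is the permutation $i\mapsto \mathrm{rk}(b_i)$, where $\mathrm{rk}(b_i)$ is the position of $b_i$ when the elements are listed in strictly increasing order. **Morse polynomials.** A real polynomial $P$ in one variable is $n$-Morse if $\deg P=n$, $P$ is monic, all its complex critical points are real and distinct (simple), and its critical values are pairwise distinct. The Arnold snake of an $n$-Morse polynomial $P$ with critical points $x_1<\cdots<x_{n-1}$ is the snake of the alternating sequence $[P(x_1),\ldots,P(x_{n-1})]$. **Separable permutations.** For permutations $\pi$ of $\{1,\ldots,p\}$ and $\tau$ of $\{1,\ldots,q\}$, the direct sum is $(\pi\oplus\tau)(i)=\pi(i)$ for $i\le p$ and $(\pi\oplus\tau)(i)=\tau(i-p)+p$ for $p<i\le p+q$; the skew sum is $(\pi\ominus\tau)(i)=\pi(i)+q$ for $i\le p$ and $(\pi\ominus\tau)(i)=\tau(i-p)$ for $p<i\le p+q$. A permutation is separable if it can be obtained by repeatedly applying $\oplus$ and $\ominus$ to the identity permutation of a single element. **Binary separating tree.** For a separable permutation $\sigma$ of $\{1,\ldots,m+1\}$, a binary separating tree is a plane rooted binary tree in which every non-leaf vertex has exactly two (ordered: left, right) children, such that: the leaves from left to right are labelled $\sigma(1),\ldots,\sigma(m+1)$;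 for each non-leaf vertex $v$ the set of labels of the leaves below $v$ is an interval (a set of consecutive integers); and $v$ is decorated by $\oplus$ if all labels below its left child are smaller than all labels below its right child, and by $\ominus$ if they are all larger. **Contact tree.** For $P,Q\in\mathbb{R}[x]$, $P\prec_+Q$ means that there is $x_0>0$ with $P(x)<Q(x)$ for all $0<x<x_0$. For nonzero $R\in\mathbb{R}[x]$, $\nu_x(R)$ is the order of vanishing of $R$ at $x=0$. Given $a_1\prec_+\cdots\prec_+a_{m+1}$ in $\mathbb{R}[x]$ with $a_i(0)=0$, the contact tree $\mathcal{CT}(a_1,\ldots,a_{m+1})$ is obtained from the half-lines $\{(t,i): t\ge 0\}$, $i=1,\ldots,m+1$, by identifying, for each $i=1,\ldots,m$, $(t,i)$ with $(t,i+1)$ for all $0\le t\le \nu_x(a_{i+1}-a_i)$. It is a rooted plane tree: the root is the common image of the points $(0,i)$; the leaves are the ends of the half-lines, the $i$-th one being labelled $a_i$ and the leaves being ordered $a_1,\ldots,a_{m+1}$; the remaining vertices are the bifurcation vertices (points of valency $\ge3$). The root has valency $1$. Saying that the contact tree is a binary separating tree of $\sigma$ means: the plane rooted tree obtained from the separating tree by attaching an extra root below its root by a single edge equals (up to isomorphism of plane rooted trees, preserving the order of leaves) the contact tree. *)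

(* Defs.v *)
From Stdlib Require Import Relation_Operators.
From HB Require Import structures.
From mathcomp Require Import all_boot all_order all_fingroup all_algebra.
From mathcomp Require Import complex.
From mathcomp Require Import boolp classical_sets functions reals constructive_ereal.

Set Implicit Arguments.
Unset Strict Implicit.
Unset Printing Implicit Defensive.

Import Order.TTheory GRing.Theory Num.Theory.

Local Open Scope ring_scope.
Local Open Scope complex_scope.

(* Permutations of {1,...,n} are elements of 'S_n: positions and values are
   shifted by one and run over 0,...,n-1. *)

Fixpoint zigzag d (T : orderType d) (up : bool) (s : seq T) : bool :=
  match s with
  | x :: ((y :: _) as s') =>
      (if up then (x < y)%O else (y < x)%O) && zigzag (~~ up) s'
  | _ => true
  end.

Definition alternating d (T : orderType d) (s : seq T) : bool :=
  uniq s && (zigzag false s || zigzag true s).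

Definition one_line n (s : 'S_n) : seq nat := [seq val (s i) | i <- enum 'I_n].

Definition is_snake n (s : 'S_n) : bool := alternating (one_line s).

Definition is_snake_of d (T : orderType d) n (b : n.-tuple T) (s : 'S_n) : Prop :=
  alternating b /\
  forall i : 'I_n, val (s i) = index (tnth b i) (sort <=%O b).

(* All complex roots z of P' are real (z = x%:C) and simple. *)
Definition is_morse (R : realType) (n : nat) (P : {poly R}) : Prop :=
  [/\ size P = n.+1,
      P \is monic,
      forall z : R[i], root (map_poly (real_complex R) P^`()) z ->
        (exists x : R, z = x%:C) /\
        mup z (map_poly (real_complex R) P^`()) = 1%N
    & forall x y : R, root P^`() x -> root P^`() y -> P.[x] = P.[y] -> x = y].

Definition arnold_snake (R : realType) n (P : {poly R}) (s : 'S_n) : Prop :=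
  exists xs : n.-tuple R,
    [/\ sorted <%R xs,
        forall x : R, root P^`() x <-> x \in xs
      & is_snake_of [tuple of map (horner P) xs] s].

Definition dsum_fun p q (s : 'S_p) (t : 'S_q) (i : 'I_(p + q)) : 'I_(p + q) :=
  match fintype.split i with
  | inl j => lshift q (s j)
  | inr j => rshift p (t j)
  end.

Definition ssum_fun p q (s : 'S_p) (t : 'S_q) (i : 'I_(p + q)) : 'I_(p + q) :=
  match fintype.split i with
  | inl j => cast_ord (addnC q p) (rshift q (s j))
  | inr j => cast_ord (addnC q p) (lshift p (t j))
  end.

Lemma dsum_fun_inj p q (s : 'S_p) (t : 'S_q) : injective (dsum_fun s t).
Proof.
move=> i j; rewrite /dsum_fun.
case: split_ordP => i' ->; case: split_ordP => j' ->.
- by move=> /lshift_inj /perm_inj ->.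
- by move=> /eqP; rewrite eq_lrshift.
- by move=> /eqP; rewrite eq_rlshift.
- by move=> /rshift_inj /perm_inj ->.
Qed.

Lemma ssum_fun_inj p q (s : 'S_p) (t : 'S_q) : injective (ssum_fun s t).
Proof.
move=> i j; rewrite /ssum_fun.
case: split_ordP => i' ->; case: split_ordP => j' -> /cast_ord_inj.
- by move=> /rshift_inj /perm_inj ->.
- by move=> /eqP; rewrite eq_rlshift.
- by move=> /eqP; rewrite eq_lrshift.
- by move=> /lshift_inj /perm_inj ->.
Qed.

Definition direct_sum p q (s : 'S_p) (t : 'S_q) : 'S_(p + q) :=
  perm (@dsum_fun_inj p q s t).

Definition skew_sum p q (s : 'S_p) (t : 'S_q) : 'S_(p + q) :=
  perm (@ssum_fun_inj p q s t).

Inductive separable_perm : forall n, 'S_n -> Prop :=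
| sep_one : separable_perm (1%g : 'S_1)
| sep_direct p q (s : 'S_p) (t : 'S_q) :
    separable_perm s -> separable_perm t -> separable_perm (direct_sum s t)
| sep_skew p q (s : 'S_p) (t : 'S_q) :
    separable_perm s -> separable_perm t -> separable_perm (skew_sum s t).

(* A plane rooted tree is given by its vertices, its root, its ancestor order
   and its leaves listed from left to right.  When, as below, every leaf is
   listed, the order of the leaves determines the plane structure (the order
   of the children of each vertex). *)
Record plane_tree := PlaneTree {
  vertex_type : Type;
  vertices : set vertex_type;
  tree_root : vertex_type;
  ancestor : vertex_type -> vertex_type -> Prop;
  tree_leaves : seq vertex_type }.

Arguments vertices : clear implicits.
Arguments tree_root : clear implicits.
Arguments tree_leaves : clear implicits.

Definition plane_tree_iso (T1 T2 : plane_tree) : Prop :=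
  exists f : vertex_type T1 -> vertex_type T2,
    [/\ set_bij (vertices T1) (vertices T2) f,
        f (tree_root T1) = tree_root T2,
        forall u v, vertices T1 u -> vertices T1 v ->
          (ancestor u v <-> ancestor (f u) (f v))
      & map f (tree_leaves T1) = tree_leaves T2].

Inductive sign := Plus | Minus.

Inductive btree :=
| Leaf of nat
| Node of sign & btree & btree.

Fixpoint labels (t : btree) : seq nat :=
  match t with
  | Leaf k => [:: k]
  | Node _ l r => labels l ++ labels r
  end.

Definition is_interval (s : seq nat) : Prop :=
  forall a b c : nat, a \in s -> c \in s -> (a <= b <= c)%N -> b \in s.

Fixpoint well_decorated (t : btree) : Prop :=
  match t with
  | Leaf _ => True
  | Node d l r =>
      [/\ is_interval (labels t),
          forall a b, a \in labels l -> b \in labels r ->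
            match d with Plus => (a < b)%N | Minus => (b < a)%N end,
          well_decorated l
        & well_decorated r]
  end.

Definition separating_tree n (s : 'S_n) (t : btree) : Prop :=
  labels t = one_line s /\ well_decorated t.

(* Vertices of a binary tree are addressed by the path from its root:
   false = left, true = right. *)
Fixpoint is_address (t : btree) (u : seq bool) : bool :=
  match u, t with
  | [::], _ => true
  | b :: u', Node _ l r => is_address (if b then r else l) u'
  | _ :: _, Leaf _ => false
  end.

Fixpoint leaf_addresses (t : btree) : seq (seq bool) :=
  match t with
  | Leaf _ => [:: [::]]
  | Node _ l r =>
      map (cons false) (leaf_addresses l) ++ map (cons true) (leaf_addresses r)
  end.

(* The plane rooted tree of t with an extra root, None, attached below. *)
Definition planted (t : btree) : plane_tree :=
  @PlaneTree (option (seq bool))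
    [set u | if u is Some u' then is_address t u' else true]
    None
    (fun u v => match u, v with
                | None, _ => True
                | Some u', Some v' => prefix u' v'
                | Some _, None => False
                end)
    (map Some (leaf_addresses t)).

Definition prec (R : realType) (P Q : {poly R}) : Prop :=
  exists x0 : R, 0 < x0 /\ forall x, 0 < x < x0 -> P.[x] < Q.[x].

Section ContactTree.
Variables (R : realType) (m : nat) (a : 'I_m.+1 -> {poly R}).

(* The point (t, i) of the i-th half-line; t = +oo is the end of the half-line.
   Points with t < 0 are not part of the tree. *)
Definition hpoint : Type := (\bar R * 'I_m.+1)%type.

(* mup 0 P is the order of vanishing at 0 of a nonzero polynomial P. *)
Inductive glue : hpoint -> hpoint -> Prop :=
| Glue (t : \bar R) (i j : 'I_m.+1) :
    val j = (val i).+1 ->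
    (0 <= t)%E -> (t <= (mup 0 (a j - a i))%:R%:E)%E ->
    glue (t, i) (t, j).

Definition same_point : hpoint -> hpoint -> Prop := clos_refl_sym_trans hpoint glue.

Definition ct_point (p : hpoint) : set hpoint := [set q | same_point p q].

(* Two half-lines through a point at height t leave it along the same edge. *)
Definition same_germ (t : \bar R) (j k : 'I_m.+1) : Prop :=
  exists2 u : \bar R, (t < u)%E &
    forall s, (t < s)%E -> (s < u)%E -> same_point (s, j) (s, k).

(* One edge towards the root if t > 0, plus the edges going up, i.e. the germs
   of half-lines at the point; no edge goes up from the end of a half-line. *)
Definition valency (p : hpoint) : nat :=
  ((0 < p.1)%E +
   (p.1 < +oo)%E *
   #|equivalence_partition (fun j k => `[< same_germ p.1 j k >])
       [set j : 'I_m.+1 | `[< same_point p (p.1, j) >]]%SET|)%N.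

Definition ct_root : set hpoint := ct_point (0%E, ord0).

Definition ct_leaf (i : 'I_m.+1) : set hpoint := ct_point (+oo%E, i).

Definition ct_bifurcation (c : set hpoint) : Prop :=
  exists p : hpoint, [/\ (0 <= p.1)%E, (3 <= valency p)%N & c = ct_point p].

Definition contact_tree : plane_tree :=
  @PlaneTree (set hpoint)
    [set c | [\/ c = ct_root, exists i, c = ct_leaf i | ct_bifurcation c]]
    ct_root
    (fun c d => exists (s t : \bar R) (i : 'I_m.+1),
       [/\ (0 <= s)%E, (s <= t)%E, c = ct_point (s, i) & d = ct_point (t, i)])
    [seq ct_leaf i | i <- enum 'I_m.+1].

End ContactTree.

Definition admissible (R : realType) m (s : 'S_m.+1) (a : 'I_m.+1 -> {poly R}) : Prop :=
  [/\ forall i, (a i).[0] = 0,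
      forall i j : 'I_m.+1, val j = (val i).+1 -> prec (a i) (a j)
    & exists t : btree,
        separating_tree s t /\ plane_tree_iso (planted t) (contact_tree a)].

(* The formal integral of p from 0 to the variable. *)
Definition poly_int (F : fieldType) (L : lalgType F) (p : {poly L}) : {poly L} :=
  \poly_(i < (size p).+1) (if i is j.+1 then (j.+1%:R : F)^-1 *: p`_j else 0).

Lemma deriv_poly_int (F : numFieldType) (L : lalgType F) (p : {poly L}) :
  (poly_int p)^`() = p.
Proof.
apply/polyP => i; rewrite coef_deriv coef_poly ltnS.
case: ltnP => [_|le]; last by rewrite mul0rn nth_default.
by rewrite -scaler_nat scalerA mulfV ?pnatr_eq0// scale1r.
Qed.

Lemma poly_int0 (F : fieldType) (L : lalgType F) (p : {poly L}) :
  (poly_int p).[0] = 0.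
Proof. by rewrite horner_coef0 coef_poly. Qed.

(* The outer variable of {poly {poly R}} is y, the inner one is x. *)
Definition Qpoly (R : realType) m (a : 'I_m.+1 -> {poly R}) : {poly {poly R}} :=
  (m.+2)%:R * poly_int (\prod_i ('X - (a i)%:P)).

Definition Qat (R : realType) m (a : 'I_m.+1 -> {poly R}) (x : R) : {poly R} :=
  map_poly (horner_eval x) (Qpoly a).

(* Main.v *)
Require Import Defs.
From Stdlib Require Import Relation_Operators.
From mathcomp Require Import all_boot all_order all_fingroup all_algebra.
From mathcomp Require Import boolp classical_sets reals constructive_ereal.
From mathcomp Require Import zify ring lra.
From mathcomp Require Import complex polyorder polyrcf.

(** The critical points of [Q_x] are [a_1(x) < ... < a_(m+1)(x)], so a difference
    of critical values is a sum of integrals [S_l] of [Q_x'] over the gaps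
    [h_l = a_(l+1) - a_l].  Up to a factor [3^(m+2)], [|S_l|] is the product of
    [h_l] and of the largest values on the gap of the factors [|t - a_j|].  If one
    gap [h_k] dominates the other gaps between [i] and [j], then [S_k] dominates
    the other [S_l], so the sign of [Q_x(a_j) - Q_x(a_i)] is that of [S_k], namely
    [(-1)^(m+1-k)], which is the sign of [sigma(k+1) - sigma(k)] because [sigma] is
    a snake descending at its end.  In a binary separating tree the paths to the
    leaves [i] and [j] split between two consecutive leaves [k] and [k+1]: there
    the order of contact is strictly smaller than at the other gaps between [i]
    and [j], so [h_k] dominates for small [x], and [sigma(j) - sigma(i)] has the
    sign of [sigma(k+1) - sigma(k)].

    Conversely, a separating tree is realized by [a_(l+1) - a_l = x^(d+1)], where
    [d] is the depth of the lowest common ancestor of the leaves [l] and [l+1]. *)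

Set Implicit Arguments.
Unset Strict Implicit.
Unset Printing Implicit Defensive.

Import Order.TTheory GRing.Theory Num.Theory.
Local Open Scope ring_scope.

(** * Dominant increments of a real-rooted primitive *)

Section CriticalValues.
Variables (R : rcfType) (m : nat) (a : nat -> R).
Hypothesis a_lt : forall l, (l < m)%N -> a l < a l.+1.

Let gap l := a l.+1 - a l.

Lemma node_le i j : (i <= j <= m)%N -> a i <= a j.
Proof.
elim: j => [|j IH]; first by rewrite leqn0 => /andP[/eqP->].
case/andP; rewrite leq_eqVlt => /orP[/eqP->//|ij] jm.
by apply: (le_trans (IH _) (ltW (a_lt jm))); lia.
Qed.

(* [|t - a j|] for [t] in the gap [(a k, a k.+1)], and its supremum over the gap. *)
Definition abs_factor (k : nat) (t : R) (j : nat) : R :=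
  if (j <= k)%N then t - a j else a j - t.

Definition max_factor (k j : nat) : R :=
  if (j <= k)%N then a k.+1 - a j else a j - a k.

(** The product of the suprema, rather than the supremum of the product, can be compared factor by
    factor between two gaps. *)
Let W k : R := \prod_(j < m.+1) max_factor k j.

Lemma max_factor_gt0 k j : (k < m)%N -> (j < m.+1)%N -> 0 < max_factor k j.
Proof.
move=> km jm; rewrite /max_factor; case: leqP => jk; rewrite subr_gt0.
  by apply: (le_lt_trans (node_le _) (a_lt km)); lia.
by apply: (lt_le_trans (a_lt km)); apply: node_le; lia.
Qed.

Lemma W_gt0 k : (k < m)%N -> 0 < W k.
Proof. by move=> km; apply: prodr_gt0 => j _; apply: max_factor_gt0. Qed.

(** Each of the [m - k] indices above [k] changes the sign of its factor once. *)
Lemma abs_factorE k (t : R) : (k <= m)%N ->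
  \prod_(j < m.+1) abs_factor k t j = (-1) ^+ (m - k) * \prod_(j < m.+1) (t - a j).
Proof.
move=> km.
have -> : (-1) ^+ (m - k) = \prod_(j < m.+1) (if (j <= k)%N then 1 else -1) :> R.
  rewrite (bigID (fun j : 'I_m.+1 => (j <= k)%N)) /= big1 ?mul1r; last by move=> i ->.
  under eq_bigr => i /negbTE -> do [].
  rewrite prodr_const; congr (_ ^+ _).
  have -> : #|[pred i : 'I_m.+1 | ~~ (i <= k)%N]| = (m.+1 - #|[pred i : 'I_m.+1 | (i < k.+1)%N]|)%N.
    rewrite -[X in (X - _)%N](card_ord m.+1) -(cardC [pred i : 'I_m.+1 | (i < k.+1)%N]) addKn.
    by apply: eq_card => i; rewrite !inE.
  have -> : #|[pred i : 'I_m.+1 | (i < k.+1)%N]| = k.+1; last by rewrite subSS.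
  rewrite -sum1_card.
  by rewrite -(big_ord_widen_cond m.+1 xpredT (fun=> 1%N)) ?sum1_card ?card_ord.
rewrite -big_split /=; apply: eq_bigr => j _; rewrite /abs_factor.
by case: ifP => _; rewrite ?mul1r// mulN1r opprB.
Qed.

Lemma abs_factor_bounds k t j : (k < m)%N -> (j < m.+1)%N ->
  a k <= t <= a k.+1 -> 0 <= abs_factor k t j <= max_factor k j.
Proof.
move=> km jm /andP[kt tk]; rewrite /abs_factor /max_factor; case: leqP => jk.
  by have := @node_le j k; rewrite jk ltnW// => /(_ isT); lra.
by have := @node_le k.+1 j; rewrite jk -ltnS jm => /(_ isT); lra.
Qed.

(** The distance from [a j] to [t] contains at least a third of the gap and the whole stretch from
    [a j] to the near end of the gap, while [max_factor k j] is that stretch plus the full gap. *)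
Lemma abs_factor_third k t j : (k < m)%N -> (j < m.+1)%N ->
  a k + gap k / 3 <= t <= a k.+1 - gap k / 3 -> max_factor k j / 3 <= abs_factor k t j.
Proof.
rewrite /gap => km jm /andP[kt tk]; rewrite /abs_factor /max_factor; case: leqP => jk.
  by have := @node_le j k; rewrite jk ltnW// => /(_ isT); lra.
by have := @node_le k.+1 j; rewrite jk -ltnS jm => /(_ isT); lra.
Qed.

Variables (c : R) (F : {poly R}).
Hypothesis c_gt0 : 0 < c.
Hypothesis derF : F^`() = c *: \prod_(j < m.+1) ('X - (a j)%:P).

Lemma signed_derF k t : (k <= m)%N ->
  ((-1) ^+ (m - k) *: F)^`().[t] = c * \prod_(j < m.+1) abs_factor k t j.
Proof.
move=> km; rewrite derivZ derF !hornerZ abs_factorE// mulrCA; congr (_ * (_ * _)).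
by rewrite horner_prod; apply: eq_bigr => j _; rewrite !hornerE.
Qed.

(** The mean value theorem gives the upper bound. For the lower one, the signed primitive is
    nondecreasing on the gap, so its increment is at least the one over the middle third; the [m.+1]
    factors and the length of the interval lose at most a factor 3 each. *)
Lemma increment_bounds k : (k < m)%N ->
  c * (gap k * W k) / 3 ^+ m.+2 <= (-1) ^+ (m - k) * (F.[a k.+1] - F.[a k]) <= c * (gap k * W k).
Proof.
move=> km; have akk := a_lt km.
have gap_gt0 : 0 < gap k by rewrite subr_gt0.
pose G := (-1) ^+ (m - k) *: F.
have -> : (-1) ^+ (m - k) * (F.[a k.+1] - F.[a k]) = G.[a k.+1] - G.[a k].
  by rewrite !hornerZ mulrBr.
have dG t : G^`().[t] = c * \prod_(j < m.+1) abs_factor k t j.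
  by apply: signed_derF; rewrite ltnW.
have dG_bnd t : a k <= t <= a k.+1 -> 0 <= G^`().[t] <= c * W k.
  move=> tk; rewrite dG ler_pM2l//; apply/andP; split.
    rewrite mulr_ge0 ?(ltW c_gt0)//; apply: prodr_ge0 => j _.
    by have /andP[] := abs_factor_bounds km (ltn_ord j) tk.
  by apply: ler_prod => j _; apply: abs_factor_bounds.
apply/andP; split; last first.
  have [t tk ->] := poly_mvt G akk.
  rewrite mulrA [c * _ * _]mulrAC ler_pM2r//.
  have tb : a k <= t <= a k.+1 by rewrite !(itvP tk).
  by have /andP[] := dG_bnd t tb.
have incr u v : a k <= u -> u < v -> v <= a k.+1 -> G.[u] <= G.[v].
  move=> ku uv vk; rewrite -subr_ge0.
  have [t tk ->] := poly_mvt G uv.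
  have /andP[tu tv] : u < t < v by rewrite !(itvP tk).
  have /andP[dt _] := dG_bnd t (ltac:(lra)).
  by rewrite mulr_ge0// subr_ge0 ltW.
(* On the middle third of the gap every factor is at least a third of its
   supremum. *)
have mid : a k + gap k / 3 < a k.+1 - gap k / 3 by rewrite /gap; lra.
apply: (@le_trans _ _ (G.[a k.+1 - gap k / 3] - G.[a k + gap k / 3])); last first.
  by apply: lerB; apply: incr; rewrite /gap; lra.
have [t tk ->] := poly_mvt G mid.
have tb : a k + gap k / 3 <= t <= a k.+1 - gap k / 3 by rewrite !(itvP tk).
have -> : a k.+1 - gap k / 3 - (a k + gap k / 3) = gap k / 3 by rewrite /gap; field.
have -> : c * (gap k * W k) / 3 ^+ m.+2 = c * (W k / 3 ^+ m.+1) * (gap k / 3).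
  by rewrite [3 ^+ m.+2]exprS; field; rewrite expf_neq0// pnatr_eq0.
apply: ler_wpM2r; first by rewrite divr_ge0 ?(ltW gap_gt0).
rewrite dG ler_pM2l//.
have -> : W k / 3 ^+ m.+1 = \prod_(j < m.+1) (max_factor k j / 3).
  by rewrite big_split /= prodr_const card_ord exprVn.
apply: ler_prod => j _; rewrite (abs_factor_third km (ltn_ord j) tb) andbT.
by rewrite divr_ge0// ltW// max_factor_gt0.
Qed.

(** * Comparison of the gaps between [i] and [j] with a dominant gap [k] *)

Variables (i j k : nat) (eps : R).
Hypotheses (ik : (i <= k)%N) (kj : (k < j)%N) (jm : (j <= m)%N).
Hypothesis gap_small : forall l, (i <= l < j)%N -> l != k -> gap l <= eps * gap k.
Hypothesis eps_ge0 : 0 <= eps.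

Let km : (k < m)%N. Proof. exact: leq_trans kj jm. Qed.

Lemma gap_k_gt0 : 0 < gap k. Proof. by rewrite subr_gt0 a_lt. Qed.

(** Away from [k] at most [m] gaps are added, each at most [eps * gap k]. *)
Lemma gap_sum_small p q : m%:R * eps <= 1 ->
  (i <= p <= q)%N -> (q <= j)%N -> ~~ (p <= k < q)%N -> a q - a p <= gap k.
Proof.
move=> me ipq qj npq; have gk := gap_k_gt0.
suff le_sum : a q - a p <= (q - p)%:R * eps * gap k.
  apply: (le_trans le_sum); rewrite -[leRHS]mul1r ler_pM2r//.
  apply: le_trans me; apply: ler_wpM2r => //; rewrite ler_nat.
  by lia.
case/andP: ipq qj npq => ip; elim: q => [|q IH].
  by rewrite leqn0 => /eqP-> *; rewrite subrr mul0r mul0r.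
rewrite leq_eqVlt => /orP[/eqP->|]; first by rewrite subrr subnn !mul0r.
rewrite ltnS => pq qj npq; rewrite subSn// -natr1 !mulrDl mul1r.
have := IH pq (ltnW qj) (ltac:(lia)); have := gap_small (l := q) (ltac:(lia)) (ltac:(lia)).
by rewrite {1}/gap; lra.
Qed.

(** Each [max_factor] is the distance from [a p] to the far end of a gap. Passing from gap [k] to
    gap [l] lengthens it by at most a stretch that avoids gap [k], hence by at most [gap k], which
    never exceeds [max_factor k p]. *)
Lemma max_factor_ratio l p : m%:R * eps <= 1 ->
  (i <= l < j)%N -> l != k -> (p < m.+1)%N -> max_factor l p <= 2 * max_factor k p.
Proof.
move=> me /andP[il lj] lk pm; have gk := gap_k_gt0; have small := gap_sum_small me.
rewrite /max_factor; case: (ltngtP l k) lk => // lk _.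
- case: (leqP p l) => pl.
    rewrite (leq_trans pl (ltnW lk)).
    have := @node_le l.+1 k (ltac:(lia)); have := a_lt km.
    by have := @node_le p k (ltac:(lia)); lra.
  case: (leqP p k) => pk.
    have := small l p (ltac:(lia)) (ltac:(lia)) (ltac:(lia)).
    by have := @node_le p k (ltac:(lia)); rewrite /gap in gk *; lra.
  have := small l k (ltac:(lia)) (ltac:(lia)) (ltac:(lia)).
  by have := @node_le k.+1 p (ltac:(lia)); rewrite /gap in gk *; lra.
- case: (leqP p k) => pk.
    rewrite (leq_trans pk (ltnW lk)).
    have := small k.+1 l.+1 (ltac:(lia)) (ltac:(lia)) (ltac:(lia)).
    by have := @node_le p k (ltac:(lia)); rewrite /gap in gk *; lra.
  case: (leqP p l) => pl.
    have := small p l.+1 (ltac:(lia)) (ltac:(lia)) (ltac:(lia)).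
    by have := @node_le k.+1 p (ltac:(lia)); rewrite /gap in gk *; lra.
  have := @node_le l p (ltac:(lia)); have := @node_le k l (ltac:(lia)).
  by lra.
Qed.

(** In the telescoping sum the term of gap [k] is at least [B / 3 ^+ m.+2], and the others, fewer
    than [m.+1] in number, are at most [2 ^+ m.+1 * eps * B] in absolute value. The constant in the
    hypothesis lets the former outweigh all the latter. *)
Lemma critical_value_sign : m.+1%:R * 2 ^+ m.+1 * 3 ^+ m.+2 * eps <= 1 ->
  0 < (-1) ^+ (m - k) * (F.[a j] - F.[a i]).
Proof.
move=> small; have gk := gap_k_gt0; have Wk := W_gt0 km.
have p2 : 1 <= 2 ^+ m.+1 :> R by rewrite exprn_ege1 ?ler1n.
have p3 : 1 <= 3 ^+ m.+2 :> R by rewrite exprn_ege1 ?ler1n.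
have me : m%:R * eps <= 1.
  apply: le_trans small; apply: ler_wpM2r => //.
  rewrite -mulrA; apply: (@le_trans _ _ (m.+1%:R)); first by rewrite ler_nat.
  by rewrite ler_peMr// mulr_ege1.
have ge_W l : (i <= l < j)%N -> l != k -> W l <= 2 ^+ m.+1 * W k.
  move=> lij lk.
  have -> : 2 ^+ m.+1 * W k = \prod_(p < m.+1) (2 * max_factor k p).
    by rewrite big_split /= prodr_const card_ord.
  apply: ler_prod => p _; rewrite max_factor_ratio// andbT ltW//.
  by apply: max_factor_gt0 => //; lia.
pose D l := (-1) ^+ (m - k) * (F.[a l.+1] - F.[a l]).
have -> : (-1) ^+ (m - k) * (F.[a j] - F.[a i]) = \sum_(i <= l < j) D l.
  rewrite -mulr_sumr; congr (_ * _).
  by rewrite telescope_sumr//; lia.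
pose B := c * (gap k * W k); have B_gt0 : 0 < B by rewrite !mulr_gt0.
have D_small l : (i <= l < j)%N -> l != k -> `|D l| <= 2 ^+ m.+1 * eps * B.
  move=> lij lk; have lm : (l < m)%N by lia.
  have gl : 0 < gap l by rewrite subr_gt0 a_lt.
  have /andP[lo up] := increment_bounds lm.
  (* The sign in [D l] belongs to gap [k]; the absolute value trades it for the sign of gap [l],
     which makes the increment nonnegative. *)
  have -> : `|D l| = (-1) ^+ (m - l) * (F.[a l.+1] - F.[a l]).
    rewrite /D -[RHS]ger0_norm; first by rewrite !normrM !normrX !normrN1 !expr1n.
    apply: le_trans lo; rewrite !mulr_ge0 ?invr_ge0 ?exprn_ge0//.
    - exact: ltW c_gt0.
    - exact: ltW gl.
    - exact/ltW/W_gt0.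
  apply: (le_trans up).
  have -> : 2 ^+ m.+1 * eps * B = c * ((eps * gap k) * (2 ^+ m.+1 * W k)) by rewrite /B; ring.
  rewrite ler_pM2l//; apply: ler_pM; rewrite ?(ltW gl) ?(ltW (W_gt0 _))//.
  + exact: gap_small.
  + exact: ge_W.
rewrite (big_cat_nat ik (ltnW kj)) /= [\sum_(k <= _ < j) _]big_ltn//.
have rest u v : (i <= u)%N -> (v <= j)%N -> ~~ (u <= k < v)%N ->
    - ((v - u)%:R * (2 ^+ m.+1 * eps * B)) <= \sum_(u <= l < v) D l.
  move=> iu vj nk; rewrite mulr_natl -sumr_const_nat -sumrN.
  apply: ler_sum_nat => l luv; have := D_small l (ltac:(lia)) (ltac:(lia)).
  by rewrite ler_norml => /andP[].
have := rest i k (leqnn _) (ltnW kj) (ltac:(lia)).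
have := rest k.+1 j (ltac:(lia)) (leqnn _) (ltac:(lia)).
have /andP[lo _] := increment_bounds km; rewrite -/B -/(D k) in lo.
have : ((k - i)%:R + (j - k.+1)%:R) * (2 ^+ m.+1 * eps * B) < B / 3 ^+ m.+2.
  have ltm : ((k - i) + (j - k.+1) < m.+1)%N by lia.
  have -> : B / 3 ^+ m.+2 = (3 ^+ m.+2)^-1 * B by rewrite mulrC.
  rewrite -natrD mulrA ltr_pM2r//.
  have q3 : 0 < 3 ^+ m.+2 :> R by rewrite exprn_gt0.
  rewrite -(ltr_pM2r q3) mulVf ?gt_eqF//.
  (* The strict comparison of numbers of gaps may only be multiplied by a positive factor, so a
     vanishing [eps] is treated apart. *)
  have [->|e0] := eqVneq eps 0; first by rewrite !(mulr0, mul0r) ltr01.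
  apply: lt_le_trans small.
  have -> : m.+1%:R * 2 ^+ m.+1 * 3 ^+ m.+2 * eps = m.+1%:R * (2 ^+ m.+1 * eps) * 3 ^+ m.+2 by ring.
  rewrite ltr_pM2r// ltr_pM2r ?ltr_nat//.
  by rewrite mulr_gt0 ?exprn_gt0// lt_neqAle eq_sym e0.
by lra.
Qed.

End CriticalValues.

(** * Leaf addresses of binary trees *)

Section CommonPrefix.
Variable T : eqType.

(** Longest common prefix: for two addresses in a tree, the address of their lowest common
    ancestor. *)
Fixpoint lcp (u v : seq T) : seq T :=
  match u, v with
  | x :: u', y :: v' => if x == y then x :: lcp u' v' else [::]
  | _, _ => [::]
  end.

Lemma lcpC u v : lcp u v = lcp v u.
Proof. by elim: u v => [|x u IH] [|y v] //=; rewrite eq_sym IH; case: eqP => [->|]. Qed.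

Lemma prefix_lcp (w u v : seq T) : prefix w (lcp u v) = prefix w u && prefix w v.
Proof.
elim: u v w => [|x u IH] [|y v] [|z w] //=; rewrite ?andbF ?prefix0s //.
have [<-|xy] := eqVneq x y; first by rewrite /= IH; case: (z == x).
by rewrite /=; case: eqP => // ->; rewrite (negbTE xy) andbF.
Qed.

Lemma prefix_lcpl u v : prefix (lcp u v) u.
Proof. by have := prefix_refl (lcp u v); rewrite prefix_lcp => /andP[]. Qed.

Lemma prefix_lcpr u v : prefix (lcp u v) v.
Proof. by rewrite lcpC prefix_lcpl. Qed.

(** The ancestors of a vertex form a chain ordered by depth. *)
Lemma prefix_size_le (w u v : seq T) :
  prefix u w -> prefix v w -> (size u <= size v)%N -> prefix u v.
Proof.
rewrite !prefixE => /eqP uw /eqP vw le.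
by rewrite -vw take_takel// uw.
Qed.

End CommonPrefix.

Lemma size_leaf_addresses t : size (leaf_addresses t) = size (labels t).
Proof. by elim: t => //= _ l IHl r IHr; rewrite !size_cat !size_map IHl IHr. Qed.

Lemma size_labels_gt0 t : (0 < size (labels t))%N.
Proof. by elim: t => //= _ l IH r _; rewrite size_cat ltn_addr. Qed.

Definition leaf_address t i := nth [::] (leaf_addresses t) i.

Lemma leaf_address_node d l r i : (i < size (labels (Node d l r)))%N ->
  leaf_address (Node d l r) i =
  if (i < size (labels l))%N then false :: leaf_address l i
  else true :: leaf_address r (i - size (labels l)).
Proof.
rewrite /leaf_address /= size_cat => ilt; rewrite nth_cat size_map size_leaf_addresses.
case: ltnP => il; rewrite (nth_map [::]) ?size_leaf_addresses//; lia.
Qed.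

Lemma uniq_leaf_addresses t : uniq (leaf_addresses t).
Proof.
have consI b : injective (@cons bool b) by move=> ? ? [].
elim: t => //= _ l ul r ur; rewrite cat_uniq !map_inj_uniq ?ul ?ur ?andbT//=.
by apply/hasPn => ? /mapP[u _ ->]; apply/mapP => -[].
Qed.

Lemma is_address_prefix t u v : prefix u v -> is_address t v -> is_address t u.
Proof.
elim: t u v => [k|d l IHl r IHr] [|b u] [|b' v] //.
by rewrite prefix_cons /= => /andP[/eqP <-]; case: b; [exact: IHr|exact: IHl].
Qed.

Lemma leaf_is_address t u : u \in leaf_addresses t -> is_address t u.
Proof.
elim: t u => [k|d l IHl r IHr] u; first by rewrite inE => /eqP->.
by rewrite mem_cat => /orP[] /mapP[v]; [move/IHl|move/IHr] => ? ->.
Qed.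

Lemma has_leaf_above t u : is_address t u -> has (prefix u) (leaf_addresses t).
Proof.
have nil_case s : has (prefix [::]) (leaf_addresses s).
  rewrite (@eq_has _ _ predT) ?has_predT ?size_leaf_addresses ?size_labels_gt0// => v.
  by rewrite prefix0s.
elim: t u => [k|d l IHl r IHr] [|b u] // ad; rewrite has_cat !has_map.
by case: b ad => [/IHr|/IHl] h; apply/orP; [right|left];
  apply: sub_has h => v; rewrite /= ?eqxx.
Qed.

Lemma leaf_maximal t u v : u \in leaf_addresses t -> is_address t v -> prefix u v -> v = u.
Proof.
elim: t u v => [k|d l IHl r IHr] u v; first by rewrite inE => /eqP-> /=; case: v.
rewrite mem_cat => /orP[] /mapP[w wl ->]; case: v => [|b v] //= ad /andP[/eqP bE p];
  rewrite -{}bE in ad *; congr (_ :: _).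
- exact: IHl p.
- exact: IHr p.
Qed.

(** The vertex where the paths to two consecutive leaves part. It is the counterpart in the tree of
    the contact order of two consecutive branches. *)
Definition split_address t l := lcp (leaf_address t l) (leaf_address t l.+1).

(* The split position between two leaves is where their lowest common ancestor
   separates its left subtree from its right one. *)
Lemma split_position t i j : (i < j < size (labels t))%N ->
  exists k, [/\ (i <= k < j)%N,
    split_address t k = lcp (leaf_address t i) (leaf_address t j),
    forall l, (i <= l < j)%N -> l != k ->
      prefix (split_address t k) (split_address t l) /\
      (size (split_address t k) < size (split_address t l))%N
  & well_decorated t ->
    let s := labels t in (nth 0 s i < nth 0 s j)%N = (nth 0 s k < nth 0 s k.+1)%N].
Proof.
elim: t i j => [k|d lt IHl rt IHr] i j; first by move=> /=; lia.
set n := size (labels lt); case/andP=> ij jn.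
have n_gt0 : (0 < n)%N by apply: size_labels_gt0.
have adE p : (p <= j)%N -> leaf_address (Node d lt rt) p =
  if (p < n)%N then false :: leaf_address lt p else true :: leaf_address rt (p - n).
  by move=> pj; rewrite leaf_address_node//; apply: leq_ltn_trans jn.
have splE p : (p < j)%N -> split_address (Node d lt rt) p =
    if (p.+1 < n)%N then false :: split_address lt p
    else if (n <= p)%N then true :: split_address rt (p - n) else [::].
  move=> pj; rewrite /split_address !adE ?(ltnW pj)//.
  case: (ltnP p.+1 n) => pn; first by rewrite (ltnW pn).
  by case: (ltnP p n) => np //; rewrite subSn.
have labE p : nth 0%N (labels (Node d lt rt)) p =
  if (p < n)%N then nth 0%N (labels lt) p else nth 0%N (labels rt) (p - n).
  by rewrite nth_cat.
have jn' : (j < n + size (labels rt))%N by move: jn; rewrite /= size_cat.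
(* Either both leaves lie in one subtree, where the induction hypothesis applies, or the root
   separates them and the split position is the last leaf [n.-1] of the left subtree. *)
have [jln|njn] := ltnP j n.
- have [|k [ikj kE kmin kd]] := IHl i j; first by rewrite ij.
  exists k; split=> //.
  + have kn : (k.+1 < n)%N by lia.
    by rewrite splE ?adE ?jln ?(ltn_trans ij jln) ?kn ?kE ?eqxx //; lia.
  + move=> l lij lk; have [p s] := kmin l lij lk.
    have kn : (k.+1 < n)%N by lia.
    have ln : (l.+1 < n)%N by lia.
    by rewrite !splE ?kn ?ln /= ?eqxx//; lia.
  + move=> [_ _ wl _] /=; rewrite !labE !ifT; [exact: kd|lia..].
- have [nin|ni] := leqP n i.
  have [|k [ikj kE kmin kd]] := IHr (i - n)%N (j - n)%N; first by lia.
  exists (k + n)%N; split=> //; first by lia.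
  + have -> : split_address (Node d lt rt) (k + n) = true :: split_address rt k.
      by rewrite splE ?leq_addl ?addnK ?ifF//; lia.
    by rewrite !adE ?(ltnW ij)// !ltnNge nin njn /= kE.
  + move=> l lij lk; have [||p s] := kmin (l - n)%N; [lia..|].
    have -> : split_address (Node d lt rt) (k + n) = true :: split_address rt k.
      by rewrite splE ?leq_addl ?addnK ?ifF//; lia.
    have ln : (l.+1 < n)%N = false by lia.
    have nl : (n <= l)%N by lia.
    by rewrite splE ?ln ?nl /= ?eqxx//; lia.
  + move=> [_ _ _ wr] /=; rewrite !labE.
    have -> : ((k + n).+1 < n)%N = false by lia.
    have -> : ((k + n) < n)%N = false by lia.
    have -> : (i < n)%N = false by lia.
    have -> : (j < n)%N = false by lia.
    by rewrite kd// -addSn !addnK.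
- have n1 : n.-1.+1 = n by rewrite prednK.
  have nlast : split_address (Node d lt rt) n.-1 = [::].
    by rewrite splE ?n1 ?ltnn; [rewrite ifF//; lia|lia].
  exists n.-1; split; first by lia.
  + by rewrite nlast !adE ?(ltnW ij)// ni ltnNge njn.
  + move=> l lij lk; rewrite nlast splE; last by lia.
    by split=> //; do 2?case: ifP => //; lia.
  (* Each comparison is between a label of the left subtree and one of the right subtree, so the
     decoration of the root decides both alike. *)
  + move=> [_ wd _ _] /=; rewrite !labE n1 ltnn ni [(j < n)%N]ltnNge njn subnn leqnn /=.
    have m1 : nth 0%N (labels lt) i \in labels lt by rewrite mem_nth.
    have m2 : nth 0%N (labels lt) n.-1 \in labels lt by rewrite mem_nth // -/n n1.
    have m3 : nth 0%N (labels rt) (j - n) \in labels rt by rewrite mem_nth // ltn_subLR.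
    have m4 : nth 0%N (labels rt) 0 \in labels rt by rewrite mem_nth// size_labels_gt0.
    have := wd _ _ m1 m3; have := wd _ _ m2 m4; clear.
    by case: d => h1 h2; [rewrite h1 h2|rewrite !ltnNge (ltnW h1) (ltnW h2)].
Qed.

(** * Contact trees *)

Section ContactTreePoints.
Variables (R : realType) (m : nat) (a : 'I_m.+1 -> {poly R}).

(** Natural indices allow arithmetic on positions; the value is meaningful for [l < m], where
    [inord] does not fall back on its default. *)
Definition contact_order (l : nat) : nat :=
  mup 0 (a (inord l.+1) - a (inord l)).

Local Notation e l := ((contact_order l)%:R%:E : \bar R).

Definition between (i j l : nat) : bool := (minn i j <= l < maxn i j)%N.

(** An explicit form of the equivalence generated by [glue]. The alternative [p.2 = q.2] also covers
    points of negative height, which are glued to no other point. *)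
Definition joined (p q : \bar R * 'I_m.+1) : Prop :=
  p.1 = q.1 /\
  (p.2 = q.2 \/ (0 <= p.1)%E /\ forall l, between p.2 q.2 l -> (p.1 <= e l)%E).

(** For transitivity, a gap between [u] and [w] lies between [u] and [v] or between [v] and [w].
    Conversely, the gluings of consecutive half-lines are chained from one index to the other. *)
Lemma same_pointP p q : same_point a p q <-> joined p q.
Proof.
split.
  elim=> [_ _ [t i j ij t0 te]|u|u v _ [st h]|u v w _ [uv h1] _ [vw h2]].
  - rewrite /= in ij; split=> //=; right; split=> // l lij.
    have -> : l = i by move: lij; rewrite /between /=; lia.
    rewrite /contact_order; have -> : inord i = i by apply: val_inj; rewrite /= inordK.
    by have -> : inord i.+1 = j by apply: val_inj; rewrite /= inordK -?ij.
  - by split=> //; left.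
  - split=> //; case: h => [->|[s0 h]]; first by left.
    by right; rewrite -st; split=> // l lvu; apply: h; move: lvu; rewrite /between /=; lia.
  - split; first by rewrite uv.
    case: h1 h2 => [-> [->|[v0 h2]]|[u0 h1] [<-|[v0 h2]]]; [by left|right..]; rewrite ?uv//.
      by rewrite -uv; split.
    split=> // l luw; have : between u.2 v.2 l \/ between v.2 w.2 l.
      by move: luw; rewrite /between /=; lia.
    by case=> [/h1|/h2]//; rewrite uv.
case: p q => s i [t j] [/= <- [->|[s0 sij]]]; first exact: rst_refl.
have up (p q : 'I_m.+1) : (p <= q)%N -> (forall l, (p <= l < q)%N -> (s <= e l)%E) ->
    same_point a (s, p) (s, q).
  move=> pq; have [n qn] : exists n, q = (p + n)%N :> nat by exists (q - p)%N; rewrite subnKC.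
  elim: n q qn {pq} => [|n IH] q qn spq.
    have -> : q = p by apply: val_inj; rewrite /= qn addn0.
    exact: rst_refl.
  have q'm : (p + n < m.+1)%N by have := ltn_ord q; rewrite qn; lia.
  apply: (rst_trans _ _ _ (s, Ordinal q'm)).
    by apply: IH => // l /= pl; apply: spq; lia.
  apply: rst_step; apply: Glue => //=; first by move: qn; rewrite addnS.
  have := spq (p + n)%N; rewrite /contact_order.
  have -> : inord (p + n) = Ordinal q'm by apply: val_inj; rewrite /= inordK.
  have -> : inord (p + n).+1 = q by apply: val_inj; rewrite /= inordK -addnS -qn.
  by apply; lia.
have [ij|/ltnW ij] := leqP i j.
  by apply: up => // l lij; apply: sij; rewrite /between /=; lia.
by apply: rst_sym; apply: up => // l lij; apply: sij; rewrite /between /=; lia.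
Qed.

Lemma ct_point_eq p q : ct_point a p = ct_point a q <-> joined p q.
Proof.
rewrite -same_pointP; split=> [pq|pq].
  have : ct_point a q q by apply: rst_refl.
  by rewrite -pq.
rewrite /ct_point predeqE => u /=; split; last exact: rst_trans pq.
by apply: rst_trans; apply: rst_sym.
Qed.

Lemma same_germ_sym t j k : same_germ a t j k -> same_germ a t k j.
Proof. by case=> u tu h; exists u => // s ts su; apply: rst_sym; apply: h. Qed.

Lemma same_germ_trans t i j k :
  same_germ a t i j -> same_germ a t j k -> same_germ a t i k.
Proof.
case=> u tu h [v tv h']; exists (Order.min u v); first by rewrite lt_min tu.
by move=> s ts; rewrite lt_min => /andP[su sv]; apply: rst_trans (h s ts su) (h' s ts sv).
Qed.

Lemma same_germ_refl t j : (t < +oo)%E -> same_germ a t j j.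
Proof. by move=> ty; exists +oo%E => // s _ _; apply: rst_refl. Qed.

(** At any height strictly between [e l] and [u] the gap [l] already keeps the two half-lines
    apart. *)
Lemma diff_germ (j k : 'I_m.+1) l : between j k l -> ~ same_germ a (e l) j k.
Proof.
move=> jkl [u eu same].
have [s es su] : exists2 s : \bar R, (e l < s)%E & (s < u)%E.
  case: u eu {same} => [u| |] //.
    rewrite lte_fin => /midf_lt[eu ue].
    by exists (((contact_order l)%:R + u) / 2)%:E; rewrite lte_fin.
  by move=> _; exists ((contact_order l)%:R + 1)%:E; rewrite ?ltry// lte_fin ltrDl.
have /same_pointP[_ /= [jk|[_ /(_ l jkl)]]] := same s es su.
  by move: jkl; rewrite jk /between; lia.
by rewrite leNgt es.
Qed.

(** If [t] were none of the contact orders between [j] and [k], it would lie strictly below their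
    minimum [B], and the two half-lines would stay glued up to [B]. *)
Lemma diff_germ_height t (j k : 'I_m.+1) : (0 <= t)%E -> (t < +oo)%E -> joined (t, j) (t, k) ->
  ~ same_germ a t j k -> exists2 l, between j k l & t = e l.
Proof.
move=> t0 ty [_ /= jk] ngerm; apply: contrapT => nl; apply: ngerm.
case: jk => [->|[_ tjk]]; first exact: same_germ_refl.
pose B := \big[Order.min/+oo%E]_(l < m | between j k l) e l.
exists B; first last.
  move=> s ts sB; apply/same_pointP; split=> //=; right; split; first by rewrite (le_trans t0)// ltW.
  move=> l ljk; have lm : (l < m)%N.
    by move: ljk; rewrite /between; have := ltn_ord j; have := ltn_ord k; lia.
  apply: (le_trans (ltW sB)).
  exact: (@bigmin_le_cond _ _ _ _ (Ordinal lm) (fun l : 'I_m => between j k l) (fun l => e l)).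
apply: lt_bigmin => // l ljk; rewrite lt_neqAle tjk// andbT.
by apply/eqP => tl; apply: nl; exists (val l).
Qed.

(** One edge leads down, since the height is positive, and the half-lines [k] and [k.+1] leave
    upwards along different edges. *)
Lemma split_bifurcation k : (k < m)%N -> (0 < contact_order k)%N ->
  (3 <= valency a (e k, inord k))%N.
Proof.
move=> km ek; rewrite /valency /= lte_fin ltr0n ek ltry mul1n add1n ltnS.
set D := [set j : 'I_m.+1 | _]%SET.
set P := equivalence_partition _ D.
have ik : @inord m k = k :> nat by rewrite inordK// ltnS ltnW.
have ik1 : @inord m k.+1 = k.+1 :> nat by rewrite inordK.
have btw : between (@inord m k) (@inord m k.+1) k by rewrite /between ik ik1; lia.
have kD : inord k \in D by rewrite inE; apply/asboolP; apply: rst_refl.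
have k1D : inord k.+1 \in D.
  rewrite inE; apply/asboolP; apply/same_pointP; split=> //=; right.
  split; first by rewrite lee_fin ler0n.
  by move=> l; rewrite /between ik ik1 => h; have -> : l = k by lia.
clearbody D; apply/card_gt1P; exists [set y in D | `[< same_germ a (e k) (inord k) y >]]%SET,
  [set y in D | `[< same_germ a (e k) (inord k.+1) y >]]%SET; split.
- by apply/imsetP; exists (inord k).
- by apply/imsetP; exists (inord k.+1).
- apply/eqP => /setP/(_ (inord k.+1)); rewrite !inE k1D /=.
  have /asboolP -> := @same_germ_refl (e k) (inord k.+1) (ltry _).
  by move/asboolP; apply: diff_germ.
Qed.

(** At most one edge leads down, so at least two germs lead up; two half-lines representing them can
    only part at a contact order. *)
Lemma bifurcation_height p : (0 <= p.1)%E -> (3 <= valency a p)%N ->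
  exists j k : 'I_m.+1, [/\ joined p (p.1, j), joined (p.1, j) (p.1, k)
    & exists2 l, between j k l & p.1 = e l].
Proof.
case: p => t i /= t0; rewrite /valency /=.
set D := [set j : 'I_m.+1 | _]%SET; set P := equivalence_partition _ D.
case: (ltP t +oo%E) => ty; last by rewrite mul0n addn0; case: (_ < _)%E.
rewrite mul1n => P3; have /card_gt1P : (1 < #|P|)%N by move: P3; case: (0 < t)%E => /=; lia.
move=> [_ [_ [/imsetP[j jD ->] /imsetP[k kD ->] jk]]].
have inD z : z \in D -> same_point a (t, i) (t, z) by rewrite inE => h; apply/asboolP.
have ij := inD j jD; have ik := inD k kD.
have jk' : same_point a (t, j) (t, k).
  exact: (rst_trans _ _ _ _ _ (rst_sym _ _ _ _ ij) ik).
(* Half-lines with the same germ would define the same block of the partition. *)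
have ngerm : ~ same_germ a t j k.
  move=> gjk; case/eqP: jk; apply/setP => z; rewrite !inE; congr (_ && _).
  apply/asboolP/asboolP; apply: same_germ_trans => //; exact: same_germ_sym.
exists j, k; split; try exact/same_pointP.
by apply: diff_germ_height => //; exact/same_pointP.
Qed.

End ContactTreePoints.

Lemma leaf_address_mem t i : (i < size (labels t))%N -> leaf_address t i \in leaf_addresses t.
Proof. by move=> it; rewrite mem_nth// size_leaf_addresses. Qed.

Lemma split_address_is_address t l : (l < size (labels t))%N -> is_address t (split_address t l).
Proof.
move=> lt; apply: is_address_prefix (prefix_lcpl _ _) _.
exact/leaf_is_address/leaf_address_mem.
Qed.

(** The point of height [ek] on branch [k] is a vertex lying weakly below the image of
    [split_address t k]. That image is strictly below the image of [split_address t l], whose height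
    is at most the contact order at [l] because branches [l] and [l.+1] both pass through it. *)
Lemma plane_tree_iso_contact_order (R : realType) m (a : 'I_m.+1 -> {poly R}) t k l :
  size (labels t) = m.+1 ->
  plane_tree_iso (planted t) (contact_tree a) ->
  (forall i, (i < m)%N -> (0 < contact_order a i)%N) ->
  (k < m)%N -> (l < m)%N ->
  prefix (split_address t k) (split_address t l) ->
  (size (split_address t k) < size (split_address t l))%N ->
  (contact_order a k < contact_order a l)%N.
Proof.
move=> sz [f [[fV finj fsurj] _ fanc fleaves]] e_gt0 km lm kl skl.
have leafE i : (i < m.+1)%N -> f (Some (leaf_address t i)) = ct_leaf a (inord i).
  move=> im; have szl : size (leaf_addresses t) = m.+1 by rewrite size_leaf_addresses.
  have := congr1 (fun s => nth (ct_root a) s i) fleaves; rewrite /=.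
  rewrite (nth_map None) ?size_map ?szl// (nth_map [::]) ?szl// => ->.
  rewrite (nth_map ord0) ?size_enum_ord//; congr (ct_leaf a _).
  by apply: val_inj; rewrite /= nth_enum_ord// inordK.
have leafV i : (i < m.+1)%N -> vertices (planted t) (Some (leaf_address t i)).
  by move=> im; apply/leaf_is_address/leaf_address_mem; rewrite sz.
have splitV i : (i < m)%N -> vertices (planted t) (Some (split_address t i)).
  by move=> im; apply: split_address_is_address; rewrite sz ltnW.
pose ek : \bar R := (contact_order a k)%:R%:E.
have ek_ge0 : (0 <= ek)%E by rewrite lee_fin ler0n.
pose w := ct_point a (ek, inord k).
have k_k1 : joined a (ek, inord k) (ek, inord k.+1).
  split=> //=; right; split=> // i; rewrite /between !inordK ?ltnS ?(ltnW km)// => ?.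
  by have -> : i = k by lia.
have wV : vertices (contact_tree a) w.
  by apply: Or33; exists (ek, inord k); split=> //; apply: split_bifurcation (e_gt0 k km).
(* The preimage of [w] is an ancestor of the leaves [k] and [k.+1], hence of their lowest common
   ancestor. *)
have [u' u'V fu'] := fsurj _ wV.
have wleaf i : i = k \/ i = k.+1 -> ancestor u' (Some (leaf_address t i) : vertex_type (planted t)).
  move=> ik; have im : (i < m.+1)%N by lia.
  apply/(fanc u' (Some _)) => //; first exact: leafV.
  rewrite fu' leafE//; exists ek, +oo%E, (inord i); split=> //; first exact: leey.
  by case: ik => -> //; apply/ct_point_eq.
have u'k : ancestor u' (Some (split_address t k) : vertex_type (planted t)).
  have := wleaf k (or_introl erefl); have := wleaf _ (or_intror erefl).
  by case: (u') => //= u; rewrite prefix_lcp => -> ->.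
have /(fanc u' (Some _) u'V (splitV k km)) := u'k.
rewrite fu' => -[s1 [t1 [i1 [_ st1 /ct_point_eq [/= es1 _] ft1]]]].
have /(fanc (Some _) (Some _) (splitV k km) (splitV l lm)) :
  ancestor (Some (split_address t k) : vertex_type (planted t))
    (Some (split_address t l)) by [].
case=> s2 [t2 [i2 [s20 st2 fs2 ft2]]].
have t1s2 : t1 = s2 by move: fs2; rewrite ft1 => /ct_point_eq [].
(* Equal heights on the branch [i2] would give two vertices the same image, against injectivity. *)
have s2t2 : (s2 < t2)%E.
  rewrite lt_neqAle st2 andbT; apply/eqP => s2E.
  have [] // : Some (split_address t k) = Some (split_address t l).
    apply: finj; rewrite ?inE; [exact: splitV|exact: splitV|].
    by rewrite fs2 ft2 s2E.
  by move=> E; move: skl; rewrite E ltnn.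
have l_leaf i : i = l \/ i = l.+1 -> joined a (t2, i2) (t2, inord i).
  move=> il; have im : (i < m.+1)%N by lia.
  have /(fanc (Some _) (Some _) (splitV l lm) (leafV i im)) :
      ancestor (Some (split_address t l) : vertex_type (planted t)) (Some (leaf_address t i)).
    by case: il => ->; [exact: prefix_lcpl|exact: prefix_lcpr].
  rewrite leafE// ft2 => -[s3 [t3 [i3 [_ _ /ct_point_eq h /ct_point_eq [/= ty leaf]]]]].
  have <- : i3 = inord i; last by have [/= s3E _] := h; rewrite [X in (X, i3)]s3E.
  (* Contact orders are finite, so the ends of two distinct half-lines are never glued. *)
  case: leaf => // -[_ /= leaf]; apply: contrapT => ni.
  have [l' l'b] : exists l', between (@inord m i) i3 l'.
    exists (minn (@inord m i) i3); rewrite /between leqnn /=.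
    have : nat_of_ord i3 != @inord m i by apply: contra_notN ni => /eqP/val_inj.
    by lia.
  by have := leaf l' l'b; rewrite leNgt ltry.
have jl : joined a (t2, inord l) (t2, inord l.+1).
  apply/same_pointP; apply: (rst_trans _ _ _ (t2, i2)).
    by apply: rst_sym; apply/same_pointP; apply: l_leaf; left.
  by apply/same_pointP; apply: l_leaf; right.
have t2l : (t2 <= (contact_order a l)%:R%:E)%E.
  case: jl => _ [/(congr1 val)|[_ /= h]]; first by rewrite /= !inordK ?ltnS ?(ltnW lm)//; lia.
  by apply: h; rewrite /between !inordK ?ltnS ?(ltnW lm)//; lia.
have : (ek < (contact_order a l)%:R%:E)%E.
  by rewrite es1; apply: le_lt_trans st1 _; rewrite t1s2; apply: lt_le_trans t2l.
by rewrite lte_fin ltr_nat.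
Qed.

(** * Polynomials at the right of zero *)

Definition near0 (R : realType) (P : R -> Prop) : Prop :=
  exists x0 : R, 0 < x0 /\ forall x, 0 < x < x0 -> P x.

Section Near0.
Variable R : realType.
Implicit Types (P Q : R -> Prop) (p q : {poly R}).

Lemma near0_and P Q : near0 P -> near0 Q -> near0 (fun x => P x /\ Q x).
Proof.
move=> [u [u0 Pu]] [v [v0 Qv]]; exists (Num.min u v); rewrite lt_min u0; split=> // x.
by rewrite lt_min => /and3P[x0 xu xv]; split; [apply: Pu|apply: Qv]; rewrite x0.
Qed.

Lemma near0_imp P Q : (forall x, 0 < x -> P x -> Q x) -> near0 P -> near0 Q.
Proof.
by move=> PQ [u [u0 Pu]]; exists u; split=> // x xu; apply: PQ (Pu x xu); case/andP: xu.
Qed.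

Lemma near0_forall (P : nat -> R -> Prop) n :
  (forall l, (l < n)%N -> near0 (P l)) -> near0 (fun x => forall l, (l < n)%N -> P l x).
Proof.
elim: n => [|n IH] h; first by exists 1; split.
have := near0_and (h n (leqnn _)) (IH (fun l ln => h l (ltnW ln))).
apply: near0_imp => x _ [Pn Pl] l; rewrite ltnS leq_eqVlt => /orP[/eqP->//|]; exact: Pl.
Qed.

Lemma near0_exists P : near0 P -> exists x, 0 < x /\ P x.
Proof. by move=> [u [u0 Pu]]; exists (u / 2); split; [|apply: Pu]; lra. Qed.

Lemma near0_gt0 p : 0 < p.[0] -> near0 (fun x => 0 < p.[x]).
Proof.
move=> p0; have [d d0 pd] := poly_cont 0 p p0; exists d; split=> // x /andP[x0 xd].
by have := pd x; rewrite subr0 gtr0_norm// => /(_ xd); rewrite ltr_norml; lra.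
Qed.

(** The cofactor does not vanish at 0 because the order is exact, and a negative value there would
    make [p] negative just to the right of 0. *)
Lemma near0_gap p : near0 (fun x => 0 < p.[x]) ->
  exists2 q, p = q * 'X ^+ mup 0 p & 0 < q.[0].
Proof.
move=> pgt; have p0 : p != 0.
  by apply/eqP => p0; have [x [_]] := near0_exists pgt; rewrite p0 horner0 ltxx.
have /dvdpP[q qE] : 'X ^+ mup 0 p %| p by rewrite -['X]subr0 -mup_geq.
exists q => //; rewrite ltNge; apply/negP; rewrite le_eqVlt => /orP[/eqP q0|q0].
  have : 'X ^+ (mup 0 p).+1 %| p.
    by rewrite {2}qE exprS dvdp_mul// -['X]subr0 dvdp_XsubCl; apply/rootP.
  by rewrite -['X]subr0 -mup_geq// ltnn.
have : near0 (fun x => 0 < (- q).[x]) by apply: near0_gt0; rewrite hornerN oppr_gt0.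
move/near0_and/(_ pgt)/near0_exists => [x [x0 []]].
by rewrite qE hornerM hornerXn hornerN oppr_gt0 pmulr_lgt0 ?exprn_gt0// => /lt_trans h /h; rewrite ltxx.
Qed.

(** After division by the power of [x] in [p], the difference of the two sides has the positive
    value [eps * p'.[0]] at 0, since a positive power of [x] remains in [q]. *)
Lemma near0_small p q (eps : R) : 0 < eps ->
  near0 (fun x => 0 < p.[x]) -> near0 (fun x => 0 < q.[x]) ->
  (mup 0 p < mup 0 q)%N -> near0 (fun x => q.[x] <= eps * p.[x]).
Proof.
move=> e0 /near0_gap[p' pE p'0] /near0_gap[q' qE q'0] lt.
have : near0 (fun x => 0 < (eps *: p' - q' * 'X ^+ (mup 0 q - mup 0 p)).[x]).
  apply: near0_gt0; rewrite hornerD hornerN hornerZ hornerM hornerXn.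
  by rewrite expr0n subn_eq0 leqNgt lt mulr0 subr0 mulr_gt0.
apply: near0_imp => x x0; rewrite hornerD hornerN hornerZ hornerM hornerXn subr_gt0 => h.
rewrite pE qE -(subnK (ltnW lt)) exprD !hornerM !hornerXn !mulrA.
by rewrite ler_pM2r ?exprn_gt0// ltW.
Qed.

End Near0.

(** * Snakes *)

Lemma zigzagP d (T : orderType d) (x0 : T) (up : bool) (s : seq T) :
  zigzag up s <-> forall k, (k.+1 < size s)%N ->
    if up (+) odd k then (nth x0 s k < nth x0 s k.+1)%O
    else (nth x0 s k.+1 < nth x0 s k)%O.
Proof.
elim: s up => [|x [|y s] IH] up //; rewrite [zigzag _ _]/=; split.
  case/andP=> xy /IH zz [|k] ks; first by rewrite addbF; case: up xy {zz}.
  by have := zz k ks; rewrite /= addbN addNb.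
move=> h; apply/andP; split; first by have := h 0 isT; rewrite addbF; case: (up).
by apply/IH => k ks; have := h k.+1 ks; rewrite /= addbN addNb.
Qed.

Section SnakeOf.
Variables (d : Order.disp_t) (T : orderType d) (n : nat) (b : n.-tuple T) (s : 'S_n).
Hypothesis b_lt : forall i j, (tnth b i < tnth b j)%O = (s i < s j)%N.

Lemma tnth_inj_of_lt : injective (tnth b).
Proof.
move=> i j bij; apply: (@perm_inj _ s); apply: val_inj => /=.
by case: (ltngtP (s i) (s j)) => //; rewrite -b_lt bij ltxx.
Qed.

(** The entry of rank [k] sits at position [s^-1 k], and a sorted rearrangement is unique. *)
Lemma sort_tuple_perm : sort <=%O b = [seq tnth b ((s^-1)%g k) | k <- enum 'I_n].
Proof.
apply: (sorted_eq le_trans le_anti); first exact: sort_le_sorted.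
  rewrite sorted_map; have : sorted ltn (map val (enum 'I_n)) by rewrite val_enum_ord iota_ltn_sorted.
  rewrite sorted_map; apply: sub_sorted => i j /= ij.
  by apply: ltW; rewrite b_lt !permKV.
rewrite perm_sort -{1}(map_tnth_enum b) map_comp; apply: perm_map.
apply: uniq_perm; first exact: enum_uniq.
  by rewrite map_inj_uniq ?enum_uniq//; exact: perm_inj.
move=> i; rewrite mem_enum inE; symmetry; apply/mapP; exists (s i); rewrite ?mem_enum//.
by rewrite permK.
Qed.

(** Alternation depends only on comparisons, so it passes from [s] to [b]; the ranks are read off
    the explicit sorted list. *)
Lemma is_snake_of_lt : is_snake s -> is_snake_of b s.
Proof.
case/andP=> _ zz; split.
  apply/andP; split.
    by rewrite -(map_tnth_enum b) map_inj_uniq ?enum_uniq//; exact: tnth_inj_of_lt.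
  case: (posnP n) => [n0|n_gt0].
    by have -> : tval b = [::] by apply: size0nil; rewrite size_tuple.
  pose x0 := tnth b (Ordinal n_gt0).
  have transfer up : zigzag up (one_line s) -> zigzag up b.
    move/(zigzagP 0%N) => h; apply/(zigzagP x0) => k; rewrite size_tuple => kn.
    have nthE l (ln : (l < n)%N) : nth 0%N (one_line s) l = s (Ordinal ln).
      rewrite (nth_map (Ordinal ln)) ?size_enum_ord//; congr (val (s _)).
      by apply: val_inj; rewrite /= nth_enum_ord.
    have := h k; rewrite size_map size_enum_ord kn => /(_ isT).
    rewrite !nthE; first exact: ltnW.
    move=> kn'; rewrite -(tnth_nth x0 b (Ordinal kn')) -(tnth_nth x0 b (Ordinal kn)).
    by rewrite !b_lt.
  by case/orP: zz => /transfer ->; rewrite ?orbT.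
move=> i; rewrite sort_tuple_perm.
have -> : tnth b i = nth (tnth b i) [seq tnth b ((s^-1)%g k) | k <- enum 'I_n] (s i).
  rewrite (nth_map i) ?size_enum_ord//; congr (tnth b _).
  by rewrite nth_ord_enum permK.
rewrite index_uniq//; first by rewrite size_map size_enum_ord.
rewrite map_inj_uniq ?enum_uniq//; apply: inj_comp tnth_inj_of_lt _; exact: perm_inj.
Qed.

End SnakeOf.

(** The directions alternate, and the final descent, at [k = m.-1], fixes the phase. The parity of
    [m - k] is also the one that gives the sign of the increment over gap [k]. *)
Lemma snake_step m (s : 'S_m.+1) : (1 <= m)%N -> is_snake s ->
  (s ord_max < s (inord m.-1))%N ->
  forall k, (k < m)%N -> (nth 0 (one_line s) k < nth 0 (one_line s) k.+1)%N = ~~ odd (m - k).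
Proof.
move=> m_gt0 /andP[_ zz] last k km.
have nthE l : (l < m.+1)%N -> nth 0%N (one_line s) l = s (inord l).
  move=> lm; rewrite (nth_map ord0) ?size_enum_ord//; congr (val (s _)).
  by apply: val_inj; rewrite /= nth_enum_ord// inordK.
have {zz} [up zz] : exists up, zigzag up (one_line s) by case/orP: zz; eexists; eassumption.
have step l : (l < m)%N -> (nth 0 (one_line s) l < nth 0 (one_line s) l.+1)%N = up (+) odd l.
  move=> lm; have := (zigzagP 0%N up _).1 zz l; rewrite size_map size_enum_ord => /(_ lm).
  case: (up (+) odd l) => // lt.
  by apply/negbTE; rewrite -leqNgt; exact: ltnW.
have := step m.-1; rewrite prednK// (nthE m)// (nthE m.-1) ?prednK// => /(_ (leqnn _)).
have -> : inord m = ord_max :> 'I_m.+1 by apply: val_inj; rewrite /= inordK.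
rewrite ltnNge (ltnW last) /= => /esym/negbT; rewrite step// oddB ?(ltnW km)//.
have -> : odd m.-1 = ~~ odd m by rewrite -{2}(prednK m_gt0) /= negbK.
by rewrite addbN negbK => /eqP; case: up (odd m) (odd k) {zz step} => [] [] [].
Qed.

(** * Morse property and Arnold snake *)

Lemma size_index_enum_ord n : size (index_enum 'I_n) = n.
Proof. by rewrite /index_enum unlock -enumT size_enum_ord. Qed.

Lemma root_prod_ord_XsubC (L : idomainType) n (c : 'I_n -> L) (z : L) :
  root (\prod_i ('X - (c i)%:P)) z <-> exists i, z = c i.
Proof.
rewrite -(big_map c xpredT (fun y => 'X - y%:P)) root_prod_XsubC; split.
  by case/mapP => i _ ->; exists i.
by case=> i ->; apply/mapP; exists i; rewrite ?mem_index_enum.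
Qed.

Section QatFacts.
Variables (R : realType) (m : nat) (a : 'I_m.+1 -> {poly R}) (x : R).

Let c i := (a i).[x].

Lemma deriv_Qat : (Qat a x)^`() = m.+2%:R *: \prod_i ('X - (c i)%:P).
Proof.
rewrite /Qat /Qpoly deriv_map mulr_natl derivMn deriv_poly_int rmorphMn /= scaler_nat.
rewrite rmorph_prod; congr (_ *+ _); apply: eq_bigr => i _.
by rewrite rmorphB /= map_polyX map_polyC.
Qed.

Lemma size_Qat : size (Qat a x) = m.+3.
Proof.
have := size_deriv (Qat a x); rewrite deriv_Qat size_scale ?pnatr_eq0// size_prod_XsubC.
by rewrite size_index_enum_ord; case: (size _) => //= n <-.
Qed.

(** The factor [m.+2] of the primitive cancels the one that derivation puts on the leading
    coefficient. *)
Lemma monic_Qat : Qat a x \is monic.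
Proof.
rewrite monicE lead_coefE size_Qat /=; apply/eqP.
have := congr1 (fun p : {poly R} => p`_m.+1) deriv_Qat; rewrite coef_deriv coefZ.
have -> : (\prod_i ('X - (c i)%:P))`_m.+1 = 1.
  have := monic_prod_XsubC (index_enum 'I_m.+1) xpredT c; rewrite monicE lead_coefE size_prod_XsubC.
  by rewrite size_index_enum_ord /= => /eqP.
rewrite mulr1 => E.
have m0 : m.+2%:R != 0 :> R by rewrite pnatr_eq0.
by apply: (mulfI m0); rewrite mulr_natl E mulr1.
Qed.

Lemma root_deriv_Qat y : root (Qat a x)^`() y <-> exists i, y = c i.
Proof.
by rewrite deriv_Qat rootZ ?pnatr_eq0//; exact: root_prod_ord_XsubC.
Qed.

(** Since the [c i] are distinct, only one linear factor vanishes at each of them. *)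
Lemma deriv_Qat_complex_roots (z : R[i]%C) : injective c ->
  root (map_poly (real_complex R) (Qat a x)^`()) z ->
  (exists y : R, z = (y%:C)%C) /\ mup z (map_poly (real_complex R) (Qat a x)^`()) = 1%N.
Proof.
move=> c_inj.
have -> : map_poly (real_complex R) (Qat a x)^`() =
    m.+2%:R *: \prod_i ('X - ((c i)%:C)%C%:P).
  rewrite deriv_Qat map_polyZ /= rmorph_nat rmorph_prod; congr (_ *: _).
  by apply: eq_bigr => i _; rewrite rmorphB /= map_polyX map_polyC.
rewrite rootZ ?pnatr_eq0// => /root_prod_ord_XsubC[i ->]; split; first by exists (c i).
have sc : ~~ root (m.+2%:R%:P : {poly R[i]%C}) ((c i)%:C)%C by rewrite rootC pnatr_eq0.
rewrite -mul_polyC mupMr// (bigD1 i)//= mupMl.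
  by have := mup_XsubCX 1 ((c i)%:C)%C ((c i)%:C)%C; rewrite expr1 eqxx.
rewrite /root horner_prod prodf_seq_neq0; apply/allP => j _; apply/implyP => ji.
rewrite !hornerE subr_eq0; apply: contra_neq ji => /complexI /c_inj ->.
by [].
Qed.

End QatFacts.

(** * Order of the critical values for an admissible family *)

Section AdmissibleFamilies.
Variables (R : realType) (m : nat) (sigma : 'S_m.+1) (a : 'I_m.+1 -> {poly R}).
Hypotheses (m_gt0 : (1 <= m)%N) (snake : is_snake sigma).
Hypothesis last : (sigma ord_max < sigma (inord m.-1))%N.
Hypothesis adm : admissible sigma a.

Let b (x : R) (l : nat) : R := (a (inord l)).[x].

Lemma gap_near0 l : (l < m)%N -> near0 (fun x => 0 < (a (inord l.+1) - a (inord l)).[x]).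
Proof.
move=> lm; case: adm => _ aprec _.
have [|x0 [x0_gt0 h]] := aprec (inord l) (inord l.+1); first by rewrite /= !inordK// ltnW.
by exists x0; split=> // x /h; rewrite hornerD hornerN subr_gt0.
Qed.

(** All branches vanish at 0, so 0 is a root of each nonzero difference. *)
Lemma contact_order_gt0 l : (l < m)%N -> (0 < contact_order a l)%N.
Proof.
move=> lm; case: adm => a0 _ _.
have nz : a (inord l.+1) - a (inord l) != 0.
  by apply/eqP => E; have [x [_]] := near0_exists (gap_near0 lm); rewrite E horner0 ltxx.
rewrite /contact_order mup_geq// expr1 dvdp_XsubCl; apply/rootP.
by rewrite hornerD hornerN !a0 subrr.
Qed.

(** At the split position [k] of the leaves [i] and [j] the contact order is strictly smallest, so
    gap [k] dominates for small [x] and [critical_value_sign] applies. *)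
Lemma critical_values_near0 i j : (i < j <= m)%N -> near0 (fun x =>
  0 < (-1) ^+ (sigma (inord j) < sigma (inord i))%N * ((Qat a x).[b x j] - (Qat a x).[b x i])).
Proof.
case/andP=> ij jm; case: (adm) => _ _ [t [[tlab tdec] tiso]].
have szt : size (labels t) = m.+1 by rewrite tlab size_map size_enum_ord.
have labE l : (l < m.+1)%N -> nth 0%N (labels t) l = sigma (inord l).
  move=> lm; rewrite tlab (nth_map ord0) ?size_enum_ord//; congr (val (sigma _)).
  by apply: val_inj; rewrite /= nth_enum_ord// inordK.
have [|k [/andP[ik kj] _ kmin /(_ tdec) /= ksign]] := @split_position t i j.
  by rewrite ij szt ltnS.
have km : (k < m)%N by exact: leq_trans kj jm.
(* With [eps := C^-1] the smallness condition of [critical_value_sign] reads [C * C^-1 <= 1]. *)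
pose C : R := m.+1%:R * 2 ^+ m.+1 * 3 ^+ m.+2.
have C0 : 0 < C by apply: mulr_gt0; [apply: mulr_gt0|]; rewrite ?exprn_gt0 ?ltr0n.
have small l : (l < m)%N -> near0 (fun x => (i <= l < j)%N -> l != k ->
    b x l.+1 - b x l <= C^-1 * (b x k.+1 - b x k)).
  move=> lm; case: (boolP ((i <= l < j)%N && (l != k))); last first.
    by move=> /nandP h; exists 1; split=> // x _ lij lk; case: h; rewrite ?lij ?lk.
  case/andP=> lij lk; have [p s] := kmin l lij lk.
  have lt := plane_tree_iso_contact_order szt tiso contact_order_gt0 km lm p s.
  have : near0 (fun x => (a (inord l.+1) - a (inord l)).[x] <=
      C^-1 * (a (inord k.+1) - a (inord k)).[x]).
    by apply: near0_small lt; rewrite ?invr_gt0//; apply: gap_near0.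
  by apply: near0_imp => x _; rewrite !hornerD !hornerN.
have := near0_and (near0_forall small) (near0_forall gap_near0).
apply: near0_imp => x _ [xsmall xgap].
have b_lt l : (l < m)%N -> b x l < b x l.+1.
  by move=> /xgap; rewrite hornerD hornerN subr_gt0.
have dQ : (Qat a x)^`() = m.+2%:R *: \prod_(l < m.+1) ('X - (b x l)%:P).
  rewrite deriv_Qat; congr (_ *: _); apply: eq_bigr => l _.
  by rewrite /b inord_val.
(* From [i] to [j] the permutation moves in the same direction as at step [k], and that direction is
   given by the parity of [m - k]. *)
have -> : (-1) ^+ (sigma (inord j) < sigma (inord i))%N = (-1) ^+ (m - k) :> R.
  rewrite -[RHS]signr_odd; congr (_ ^+ nat_of_bool _).
  rewrite -[odd _]negbK -(snake_step m_gt0 snake last km) -tlab -ksign !labE//; last exact: ltn_trans ij _.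
  case: (ltngtP (sigma (inord i)) (sigma (inord j))) => // /val_inj/perm_inj/(congr1 val) /=.
  rewrite !inordK//; last exact: ltn_trans ij _.
  by move=> E; move: ij; rewrite E ltnn.
apply: (@critical_value_sign _ m (b x) b_lt m.+2%:R (Qat a x) _ dQ i j k C^-1) => //.
- by move=> l lij lk; apply: xsmall => //; case/andP: lij => _ lj; apply: leq_trans lj jm.
- by rewrite invr_ge0 ltW.
- by rewrite mulfV ?gt_eqF.
Qed.

(** Only finitely many pairs are involved, so one neighbourhood of 0 serves them all. There the
    critical values are ordered like the values of [sigma], which makes them distinct and determines
    their snake. *)
Lemma morse_arnold_near0 :
  near0 (fun x => is_morse m.+2 (Qat a x) /\ arnold_snake (Qat a x) sigma).
Proof.
have vals : near0 (fun x => forall j, (j < m.+1)%N -> forall i, (i < j)%N ->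
    0 < (-1) ^+ (sigma (inord j) < sigma (inord i))%N * ((Qat a x).[b x j] - (Qat a x).[b x i])).
  apply: near0_forall => j jm; apply: near0_forall => i ij.
  by apply: critical_values_near0; rewrite ij.
have := near0_and (near0_forall gap_near0) vals.
apply: near0_imp => x _ [xgap xval].
pose c i := (a i).[x].
have bE (i : 'I_m.+1) : b x i = c i by rewrite /b inord_val.
have b_lt l : (l < m)%N -> b x l < b x l.+1.
  by move=> /xgap; rewrite hornerD hornerN subr_gt0.
have c_lt (i j : 'I_m.+1) : (i < j)%N -> c i < c j.
  move=> ij; rewrite -!bE; have := ltn_ord j; rewrite ltnS => jm.
  apply: (lt_le_trans (b_lt i _)); first exact: leq_trans ij jm.
  by apply: (@node_le _ m (b x) b_lt); rewrite ij.
have c_inj : injective c.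
  move=> i j cij; apply: val_inj => /=; case: (ltngtP i j) => // /c_lt; by rewrite cij ltxx.
have val_lt (i j : 'I_m.+1) : (i < j)%N ->
    0 < (-1) ^+ (sigma j < sigma i)%N * ((Qat a x).[c j] - (Qat a x).[c i]).
  by move=> ij; have := xval j (ltn_ord j) i ij; rewrite !bE !inord_val.
have sigma_lt (i j : 'I_m.+1) : ((Qat a x).[c i] < (Qat a x).[c j]) = (sigma i < sigma j)%N.
  case: (ltngtP i j) => [ij|ji|/val_inj ->]; last by rewrite ltxx ltnn.
  - have := val_lt i j ij; case: (ltngtP (sigma j) (sigma i)) => [_|_|/val_inj/perm_inj E].
    + by rewrite expr1 mulN1r oppr_gt0 subr_lt0 => /lt_gtF.
    + by rewrite expr0 mul1r subr_gt0.
    + by move: ij; rewrite E ltnn.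
  - have := val_lt j i ji; case: (ltngtP (sigma i) (sigma j)) => [_|_|/val_inj/perm_inj E].
    + by rewrite expr1 mulN1r oppr_gt0 subr_lt0.
    + by rewrite expr0 mul1r subr_gt0 => /lt_gtF.
    + by move: ji; rewrite E ltnn.
split.
  split; [exact: size_Qat|exact: monic_Qat| |].
    by move=> z; apply: deriv_Qat_complex_roots.
  move=> y z /root_deriv_Qat[i ->] /root_deriv_Qat[j ->] E.
  have : ~~ (sigma i < sigma j)%N && ~~ (sigma j < sigma i)%N.
    by rewrite -!sigma_lt /c E ltxx.
  by case: (ltngtP (sigma i) (sigma j)) => // /val_inj/perm_inj ->.
exists [tuple c i | i < m.+1]; split.
- have : sorted ltn (map val (enum 'I_m.+1)) by rewrite val_enum_ord iota_ltn_sorted.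
  rewrite /= sorted_map.
  by rewrite sorted_map; apply: sub_sorted => i j; apply: c_lt.
- move=> y; rewrite root_deriv_Qat; split.
    by case=> i ->; apply/mapP; exists i; rewrite ?mem_enum.
  by case/mapP => i _ ->; exists i.
- apply: is_snake_of_lt => // i j.
  by rewrite !tnth_map !tnth_ord_tuple sigma_lt.
Qed.

End AdmissibleFamilies.

(** * Realization of separating trees *)

Fixpoint shift_labels (c : nat) (t : btree) : btree :=
  match t with
  | Leaf k => Leaf (c + k)
  | Node d l r => Node d (shift_labels c l) (shift_labels c r)
  end.

Lemma labels_shift c t : labels (shift_labels c t) = map (addn c) (labels t).
Proof. by elim: t => //= d l -> r ->; rewrite map_cat. Qed.

Lemma is_interval_shift c s : is_interval s -> is_interval (map (addn c) s).
Proof.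
move=> int x y z /mapP[x' xs ->] /mapP[z' zs ->] xyz.
have -> : y = (c + (y - c))%N by lia.
by apply: map_f; apply: (int x' _ z') => //; lia.
Qed.

Lemma well_decorated_shift c t : well_decorated t -> well_decorated (shift_labels c t).
Proof.
elim: t => // d l IHl r IHr [int dec wl wr]; split; [|move=> x y|exact: IHl|exact: IHr].
  by have := @is_interval_shift c _ int; rewrite -labels_shift.
rewrite !labels_shift => /mapP[x' xl ->] /mapP[y' yr ->].
by have := dec x' y' xl yr; case: (d); rewrite ltn_add2l.
Qed.

Lemma mem_one_line n (s : 'S_n) k : (k \in one_line s) = (k < n)%N.
Proof.
apply/mapP/idP => [[i _ ->]|kn]; first exact: ltn_ord.
by exists ((s^-1)%g (Ordinal kn)); rewrite ?mem_enum// permKV.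
Qed.

Lemma one_line_interval n (s : 'S_n) : is_interval (one_line s).
Proof. by move=> x y z; rewrite !mem_one_line => _ zn /andP[_ yz]; apply: leq_ltn_trans zn. Qed.

Lemma enum_ord_add p q :
  enum 'I_(p + q) = map (@lshift p q) (enum 'I_p) ++ map (@rshift p q) (enum 'I_q).
Proof.
apply: (inj_map val_inj); rewrite val_enum_ord map_cat iotaD add0n; congr (_ ++ _).
  by rewrite -[RHS]map_comp -val_enum_ord; apply: eq_map.
by rewrite -[RHS]map_comp -[X in iota X _]addn0 iotaDl -val_enum_ord -[LHS]map_comp; apply: eq_map.
Qed.

Lemma one_line_direct_sum p q (s : 'S_p) (t : 'S_q) :
  one_line (direct_sum s t) = one_line s ++ map (addn p) (one_line t).
Proof.
rewrite /one_line enum_ord_add map_cat; congr (_ ++ _).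
  rewrite -[LHS]map_comp; apply: eq_map => i; rewrite /= permE /dsum_fun.
  by rewrite -[lshift q i]/(unsplit (inl i)) unsplitK.
rewrite -[LHS]map_comp -[RHS]map_comp; apply: eq_map => i; rewrite /= permE /dsum_fun.
by rewrite -[rshift p i]/(unsplit (inr i)) unsplitK.
Qed.

Lemma one_line_skew_sum p q (s : 'S_p) (t : 'S_q) :
  one_line (skew_sum s t) = map (addn q) (one_line s) ++ one_line t.
Proof.
rewrite /one_line enum_ord_add map_cat; congr (_ ++ _).
  rewrite -[LHS]map_comp -[RHS]map_comp; apply: eq_map => i; rewrite /= permE /ssum_fun.
  by rewrite -[lshift q i]/(unsplit (inl i)) unsplitK.
rewrite -[LHS]map_comp; apply: eq_map => i; rewrite /= permE /ssum_fun.
by rewrite -[rshift p i]/(unsplit (inr i)) unsplitK.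
Qed.

(** The tree records the construction by sums; the block with the larger values is shifted, on the
    right for a direct sum and on the left for a skew sum. *)
Lemma separable_separating_tree n (s : 'S_n) : separable_perm s -> exists t, separating_tree s t.
Proof.
elim=> [|p q s1 s2 _ [t1 [l1 w1]] _ [t2 [l2 w2]]|p q s1 s2 _ [t1 [l1 w1]] _ [t2 [l2 w2]]].
- exists (Leaf 0); split=> //=.
  by rewrite /one_line enum_ordSl enum_ord0 /= perm1.
- exists (Node Plus t1 (shift_labels p t2)); split.
    by rewrite /= labels_shift l1 l2 one_line_direct_sum.
  split=> [|x y|//|]; last exact: well_decorated_shift.
    by rewrite /= labels_shift l1 l2 -one_line_direct_sum; apply: one_line_interval.
  rewrite labels_shift l1 l2 mem_one_line => xp /mapP[y' _ ->].
  exact: ltn_addr.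
- exists (Node Minus (shift_labels q t1) t2); split.
    by rewrite /= labels_shift l1 l2 one_line_skew_sum.
  split=> [|x y||//]; last exact: well_decorated_shift.
    by rewrite /= labels_shift l1 l2 -one_line_skew_sum; apply: one_line_interval.
  rewrite labels_shift l1 l2 mem_one_line => /mapP[x' _ ->] yp.
  exact: ltn_addr.
Qed.

(** The last leaf of the left subtree at [u] and the first leaf of its right subtree are consecutive
    and part at [u]. *)
Lemma internal_node_split t u : is_address t u -> u \notin leaf_addresses t ->
  exists2 k, (k.+1 < size (labels t))%N & split_address t k = u.
Proof.
elim: t u => [k|d l IHl r IHr] u; first by case: u => //; rewrite inE eqxx.
have consI b : injective (@cons bool b) by move=> ? ? [].
have szl := size_labels_gt0 l; have szr := size_labels_gt0 r.
case: u => [|[] u] /= ad.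
- move=> _; exists (size (labels l)).-1; rewrite ?size_cat ?prednK//; first lia.
  rewrite /split_address prednK// !leaf_address_node /= ?size_cat; [|lia..].
  by rewrite ltnn ltn_predL szl.
- rewrite mem_cat negb_or => /andP[_].
  rewrite mem_map// => /IHr[//|k kr <-]; exists (size (labels l) + k)%N; first by rewrite size_cat; lia.
  rewrite /split_address !leaf_address_node /= ?size_cat; [|lia..].
  by rewrite !ifF ?eqxx ?addKn -?addnS ?addKn //; lia.
- rewrite mem_cat negb_or => /andP[+ _].
  rewrite mem_map// => /IHl[//|k kl <-]; exists k; first by rewrite size_cat; lia.
  rewrite /split_address !leaf_address_node /= ?size_cat; [|lia..].
  by rewrite kl (ltnW kl).
Qed.

(** * Contact tree of the branches built from a separating tree *)

Section Realization.
Variables (R : realType) (m : nat) (t : btree).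
Hypothesis szt : size (labels t) = m.+1.

(* Consecutive branches separate at height one more than the depth of the lowest
   common ancestor of their leaves: the extra edge of the planted tree has
   height one. *)
Definition tree_branch (i : 'I_m.+1) : {poly R} :=
  \sum_(0 <= l < i) 'X ^+ (size (split_address t l)).+1.

Lemma tree_branchB (i j : 'I_m.+1) : val j = (val i).+1 ->
  tree_branch j - tree_branch i = 'X ^+ (size (split_address t i)).+1.
Proof. by move=> /= ij; rewrite /tree_branch ij big_nat_recr//= addrAC subrr add0r. Qed.

Lemma tree_branch0 i : (tree_branch i).[0] = 0.
Proof. by rewrite horner_sum big1// => l _; rewrite hornerXn expr0n. Qed.

Lemma tree_branch_prec (i j : 'I_m.+1) : val j = (val i).+1 ->
  prec (tree_branch i) (tree_branch j).
Proof.
move=> ij; exists 1; split=> // x /andP[x0 _].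
by rewrite -subr_gt0 -hornerN -hornerD tree_branchB// hornerXn exprn_gt0.
Qed.

Lemma contact_order_tree_branch l : (l < m)%N ->
  contact_order tree_branch l = (size (split_address t l)).+1.
Proof.
move=> lm; rewrite /contact_order tree_branchB; last by rewrite /= !inordK ?ltnS// ltnW.
have := @mup_XsubCX R (size (split_address t l)).+1 0 0.
by rewrite subr0 eqxx inordK// ltnW.
Qed.

Local Notation addr i := (leaf_address t i).
Local Notation sz u := ((size u).+1%:R%:E : \bar R).

(** Among the contact orders between two leaves the smallest is the one at their split position,
    where the split address is their lowest common ancestor. *)
Lemma joined_tree_branchP s (i j : 'I_m.+1) :
  joined tree_branch (s, i) (s, j) <-> i = j \/ (0 <= s)%E /\ (s <= sz (lcp (addr i) (addr j)))%E.
Proof.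
have main (p q : 'I_m.+1) : (p < q)%N ->
    (forall l, between p q l -> (s <= (contact_order tree_branch l)%:R%:E)%E) <->
    (s <= sz (lcp (addr p) (addr q)))%E.
  move=> pq; have [|k [kpq kE kmin _]] := @split_position t p q.
    by rewrite pq szt /=.
  have ltm l : (p <= l < q)%N -> (l < m)%N by have := ltn_ord q; lia.
  have btw l : between p q l = (p <= l < q)%N by rewrite /between; lia.
  split=> [h|h l]; first by have := h k; rewrite btw contact_order_tree_branch ?ltm// kE; apply.
  rewrite btw => lpq; rewrite contact_order_tree_branch ?ltm//; apply: (le_trans h).
  rewrite lee_fin ler_nat ltnS -kE; have [->//|lk] := eqVneq l k.
  by have [_ /ltnW] := kmin l lpq lk.
split=> [[_ /= [->|[s0 h]]]|[->|[s0 h]]]; [by left| |by split=> //; left|].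
- case: (ltngtP i j) => [ij|ji|/val_inj ->]; [right|right|by left]; split=> //.
    exact/main.
  by rewrite lcpC; apply/main => // l; rewrite /between minnC maxnC; apply: h.
- split=> //=; case: (ltngtP i j) => [ij|ji|/val_inj ->]; [right|right|by left]; split=> //.
    exact/main.
  by move=> l; rewrite /between minnC maxnC; move: l; apply/main => //; rewrite lcpC.
Qed.

(** Leaves of the contact tree are the ends of half-lines, hence the infinite height; the other
    vertices use the height of [tree_branch]. *)
Definition node_height (u : seq bool) : \bar R :=
  if u \in leaf_addresses t then +oo%E else sz u.

(** The leftmost leaf above [u], chosen to name a half-line through the vertex. *)
Definition node_leaf (u : seq bool) : 'I_m.+1 := inord (find (prefix u) (leaf_addresses t)).

Lemma node_leaf_prefix u : is_address t u -> prefix u (addr (node_leaf u)).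
Proof.
move=> ut; have hu := has_leaf_above ut.
have lt : (find (prefix u) (leaf_addresses t) < m.+1)%N.
  by rewrite -szt -size_leaf_addresses -has_find.
by rewrite /leaf_address /node_leaf inordK//; apply: nth_find.
Qed.

Lemma leaf_address_ord (i : 'I_m.+1) : addr i \in leaf_addresses t.
Proof. by apply: leaf_address_mem; rewrite szt. Qed.

Lemma leaf_address_inj (i j : 'I_m.+1) : addr i = addr j -> i = j.
Proof.
move=> /eqP; rewrite nth_uniq ?uniq_leaf_addresses ?size_leaf_addresses ?szt//.
by move=> /eqP/val_inj.
Qed.

Lemma node_height_gt0 u : (0 < node_height u)%E.
Proof. by rewrite /node_height; case: ifP => _; rewrite ?ltry// lte_fin ltr0n. Qed.

Lemma node_height_le u v : is_address t v -> prefix u v -> (node_height u <= node_height v)%E.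
Proof.
move=> vt uv; rewrite /node_height; case: (boolP (u \in _)) => ul.
  by rewrite (leaf_maximal ul vt uv) ul.
by case: ifP => _; rewrite ?leey// lee_fin ler_nat ltnS size_prefix.
Qed.

(** The point attached to [u] does not depend on the leaf chosen above [u]: two such leaves have a
    common ancestor at depth at least that of [u], and coincide if [u] is a leaf. *)
Lemma node_point u (i : 'I_m.+1) : is_address t u -> prefix u (addr i) ->
  joined tree_branch (node_height u, node_leaf u) (node_height u, i).
Proof.
move=> ut ui; have ul := node_leaf_prefix ut; apply/joined_tree_branchP.
rewrite /node_height; case: (boolP (u \in _)) => u_leaf.
  left; apply: leaf_address_inj.
  have addrT (j : 'I_m.+1) : is_address t (addr j) by exact/leaf_is_address/leaf_address_ord.
  by have -> := leaf_maximal u_leaf (addrT _) ui; exact: leaf_maximal u_leaf (addrT _) ul.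
right; split; first by rewrite lee_fin ler0n.
by rewrite lee_fin ler_nat ltnS size_prefix// prefix_lcp ul.
Qed.

Lemma node_point_prefix u s (i : 'I_m.+1) : is_address t u ->
  joined tree_branch (node_height u, node_leaf u) (s, i) -> s = node_height u /\ prefix u (addr i).
Proof.
move=> ut j; have [/= E _] := j; rewrite -E in j *; split=> //.
have ul := node_leaf_prefix ut; move/joined_tree_branchP: j => [<-//|[_]].
rewrite /node_height; case: ifP => // _; rewrite lee_fin ler_nat ltnS => le.
have := prefix_size_le ul (prefix_lcpl _ _) le; rewrite prefix_lcp => /andP[//].
Qed.

(** On the path to a given vertex, heights decide the ancestor order. *)
Lemma node_height_prefix u v w : is_address t u -> is_address t v -> is_address t w ->
  prefix u w -> prefix v w -> (node_height u <= node_height v)%E -> prefix u v.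
Proof.
move=> ut vt wt uw vw; rewrite /node_height; case: (boolP (v \in _)) => vl.
  by rewrite -(leaf_maximal vl wt vw).
case: ifP => // _; rewrite lee_fin ler_nat ltnS => le; exact: prefix_size_le uw vw le.
Qed.

Definition node_image (u : option (seq bool)) : set (hpoint R m) :=
  if u is Some v then ct_point tree_branch (node_height v, node_leaf v)
  else ct_root tree_branch.

Lemma split_address_internal l : (l < m)%N -> split_address t l \notin leaf_addresses t.
Proof.
move=> lm; apply/negP => leaf.
have eqA i : (i < m.+1)%N -> prefix (split_address t l) (addr i) -> addr i = split_address t l.
  move=> im; apply: leaf_maximal leaf _.
  by apply: leaf_is_address; apply: leaf_address_mem; rewrite szt.
have l1 : (l < m.+1)%N by apply: ltnW.
have /(congr1 val)/= : Ordinal l1 = Ordinal (lm : (l.+1 < m.+1)%N).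
  apply: leaf_address_inj => /=.
  by rewrite (eqA l l1 (prefix_lcpl _ _)) (eqA l.+1 lm (prefix_lcpr _ _)).
by lia.
Qed.

Lemma node_image_split l : (l < m)%N ->
  node_image (Some (split_address t l)) =
  ct_point tree_branch ((contact_order tree_branch l)%:R%:E, inord l).
Proof.
move=> lm; have E : node_height (split_address t l) = (contact_order tree_branch l)%:R%:E.
  by rewrite /node_height (negbTE (split_address_internal lm)) contact_order_tree_branch.
apply/ct_point_eq; rewrite -E; apply: node_point.
  by apply: split_address_is_address; rewrite szt ltnW.
by rewrite inordK ?prefix_lcpl// ltnW.
Qed.

Lemma node_image_leaf (i : 'I_m.+1) : node_image (Some (addr i)) = ct_leaf tree_branch i.
Proof.
have E : node_height (addr i) = +oo%E by rewrite /node_height leaf_address_ord.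
apply/ct_point_eq; rewrite -E; apply: node_point; last exact: prefix_refl.
exact/leaf_is_address/leaf_address_ord.
Qed.

Lemma node_image_vertex u :
  vertices (planted t) u -> vertices (contact_tree tree_branch) (node_image u).
Proof.
case: u => [u|] ut; last exact: Or31.
have [ul|ul] := boolP (u \in leaf_addresses t).
  apply: Or32; exists (node_leaf u); rewrite -node_image_leaf.
  by rewrite (leaf_maximal ul _ (node_leaf_prefix ut))//; exact/leaf_is_address/leaf_address_ord.
have [l + lu] := internal_node_split ut ul; rewrite szt ltnS => lm.
apply: Or33; exists ((contact_order tree_branch l)%:R%:E, inord l).
split; first by rewrite lee_fin ler0n.
  by apply: split_bifurcation; rewrite ?contact_order_tree_branch.
by rewrite -lu node_image_split.
Qed.

(** The root is the only vertex of height 0. Two other vertices with the same image have equal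
    heights and lie below a common leaf, so each is a prefix of the other. *)
Lemma node_image_inj : {in vertices (planted t) &, injective node_image}.
Proof.
have rootN u : node_image None <> node_image (Some u).
  by move=> /ct_point_eq[/= E _]; have := node_height_gt0 u; rewrite -E ltxx.
move=> [u|] [v|]; rewrite ?inE //= => ut vt; [|by move=> E; case: (rootN u)|by move/rootN].
move/ct_point_eq => uv; congr Some.
have [/esym E p] := node_point_prefix ut uv.
have q := node_leaf_prefix vt.
have leaf_ad : is_address t (addr (node_leaf v)) by exact/leaf_is_address/leaf_address_ord.
have uv' : prefix u v by apply: node_height_prefix p q _; rewrite ?E.
have vu' : prefix v u by apply: node_height_prefix q p _; rewrite ?E.
by move: uv'; rewrite prefixE take_oversize ?size_prefix// => /eqP.
Qed.

(** Forwards, the branch [node_leaf v] runs through both points. Backwards, both addresses are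
    prefixes of that of a common branch, and their heights compare them. *)
Lemma node_image_ancestor (u v : option (seq bool)) :
  vertices (planted t) u -> vertices (planted t) v ->
  (ancestor (u : vertex_type (planted t)) v <->
   ancestor (node_image u : vertex_type (contact_tree tree_branch)) (node_image v)).
Proof.
move=> ut vt; split.
- case: u v ut vt => [u|] [v|] //= ut vt; [move=> uv|move=> _..].
  + exists (node_height u), (node_height v), (node_leaf v); split=> //.
    * exact/ltW/node_height_gt0.
    * exact: node_height_le.
    * apply/ct_point_eq; apply: node_point => //.
      exact: prefix_trans uv (node_leaf_prefix vt).
  + exists 0%E, (node_height v), (node_leaf v); split=> //.
      exact/ltW/node_height_gt0.
    apply/ct_point_eq/joined_tree_branchP; right.
    by rewrite lexx lee_fin ler0n.
  + by exists 0%E, 0%E, ord0.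
- case=> s [r [i [s0 sr]]].
  case: u v ut vt => [u|] [v|] //= ut vt /ct_point_eq ui /ct_point_eq vi.
  + have [su pu] := node_point_prefix ut ui; have [rv pv] := node_point_prefix vt vi.
    apply: (node_height_prefix ut vt _ pu pv); last by rewrite -su -rv.
    exact/leaf_is_address/leaf_address_ord.
  + have [su _] := node_point_prefix ut ui; have [/= r0 _] := vi.
    by have := lt_le_trans (node_height_gt0 u) (ltac:(rewrite -su; exact: sr)); rewrite -r0 ltxx.
Qed.

(** A bifurcation occurs at the contact order of some gap [l] between two half-lines through it, so
    half-line [l] passes through it too and it is the image of [split_address t l]. *)
Lemma node_image_surj c : vertices (contact_tree tree_branch) c ->
  exists2 u, vertices (planted t) u & node_image u = c.
Proof.
case=> [->|[i ->]|[p [p0 p3 ->]]]; first by exists None.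
  by exists (Some (addr i)); [exact/leaf_is_address/leaf_address_ord|exact: node_image_leaf].
have [j [k [pj [_ /= jk] [l ljk pl]]]] := bifurcation_height p0 p3.
have lm : (l < m)%N by move: ljk; rewrite /between; have := ltn_ord j; have := ltn_ord k; lia.
exists (Some (split_address t l)).
  by apply: split_address_is_address; rewrite szt ltnW.
rewrite node_image_split// -pl; apply/ct_point_eq/same_pointP/rst_sym.
apply: (rst_trans _ _ _ (p.1, j)); first exact/same_pointP.
apply/same_pointP; split=> //=; right; split=> // l'.
have l'jk : between j (@inord m l) l' -> between j k l'.
  by move: ljk; rewrite /between (inordK (ltnW lm : (l < m.+1)%N)); lia.
move=> /l'jk; case: jk => [->|[_ h]]; last exact: h.
by rewrite /between; lia.
Qed.

Lemma planted_contact_tree_iso : plane_tree_iso (planted t) (contact_tree tree_branch).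
Proof.
exists node_image; split=> //.
- split=> //; [exact: node_image_vertex|exact: node_image_inj|].
  by move=> c /node_image_surj[u ut <-]; exists u.
- exact: node_image_ancestor.
- have szl : size (leaf_addresses t) = m.+1 by rewrite size_leaf_addresses.
  apply: (@eq_from_nth _ set0) => [|i]; first by rewrite /= 2!size_map szl size_map size_enum_ord.
  rewrite /= 2!size_map szl => im.
  rewrite (nth_map None) ?size_map ?szl// (nth_map [::]) ?szl// (nth_map ord0) ?size_enum_ord//.
  by rewrite (nth_ord_enum ord0 (Ordinal im)) -node_image_leaf.
Qed.

End Realization.

Lemma separable_admissible (R : realType) m (sigma : 'S_m.+1) :
  separable_perm sigma -> exists a : 'I_m.+1 -> {poly R}, admissible sigma a.
Proof.
move=> /separable_separating_tree[t tsep]; exists (tree_branch R t).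
have szt : size (labels t) = m.+1 by rewrite tsep.1 size_map size_enum_ord.
split; [exact: tree_branch0|exact: tree_branch_prec|].
by exists t; split=> //; apply: planted_contact_tree_iso.
Qed.

Theorem theorem5p1 (R : realType) (m : nat) (hm : (1 <= m)%N) (sigma : 'S_m.+1)
    (hsep : separable_perm sigma) (hsnake : is_snake sigma)
    (hlast : (val (sigma ord_max) < val (sigma (inord m.-1)))%N) :
  (exists a : 'I_m.+1 -> {poly R}, admissible sigma a) /\
  (forall a : 'I_m.+1 -> {poly R}, admissible sigma a ->
     exists x0 : R, 0 < x0 /\
       forall x : R, 0 < x < x0 ->
         is_morse m.+2 (Qat a x) /\ arnold_snake (Qat a x) sigma).
Proof.
split; first exact: separable_admissible.
by move=> a; exact: morse_arnold_near0.
Qed.
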